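(* Consider a collection of $k\ge 1$ gadget pattern pairs $\{(G_j^a,G_j^r)\mid 1\le j\le k\}$ for a maximization problem $B$ whose objective function is additive with respect to the gadgets. Let $\mathcal U_1,\dots,\mathcal U_m$ each be subuniverses for the collection, and let the universe $\mathcal U$ be the union of the subuniverses (where the number $m$ of subuniverses can be chosen arbitrarily large). Assume that, with respect to the subuniverses, the gadget pattern pairs satisfy the consistency condition for $B$, the first item condition, the distinguishing decision condition, and the disjoint copies condition. Let $s$ be the maximum number of input items in any gadget pattern in the collection. Suppose the values $\mathrm{OPT}(G_j^a),\mathrm{BAD}(G_j^a),\mathrm{OPT}(G_j^r),\mathrm{BAD}(G_j^r)$ are independent of $j$, denoted $\mathrm{OPT}(G^a),\mathrm{BAD}(G^a),\mathrm{OPT}(G^r),\mathrm{BAD}(G^r)$, and that $\mathrm{OPT}(G^r)\ge \mathrm{OPT}(G^a)$. Define $$\rho=\min\left\{\frac{\mathrm{OPT}(G^a)}{\mathrm{BAD}(G^a)},\frac{\mathrm{OPT}(G^r)}{\mathrm{BAD}(G^r)}\right\}.$$ Then for any $\epsilon\in(0,\tfrac12]$, no adaptive priority algorithm for $B$ in the oblivious priority function model using fewer than $(1-H(\epsilon))n/s$ advice bits, where $n$ is the number of input items, can achieve an approximation ratio smaller than $$1+\frac{\epsilon(\rho-1)\,\mathrm{OPT}(G^a)}{\epsilon\,\mathrm{OPT}(G^a)+(1-\epsilon)\,\rho\,\mathrm{OPT}(G^r)}.$$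
   Context: $H(p)=-p\log_2 p-(1-p)\log_2(1-p)$ is the binary entropy function. **Adaptive priority algorithm with advice.** There is a universe $\mathcal U$ of input items; an input is a finite multiset $X$ of items. An oracle that knows the algorithm and all of $X$ (and how ties will be broken) writes an infinite binary advice tape. The deterministic algorithm may first read some bits of the tape, sequentially. Then, in iteration $i=1,2,\dots$ until $X$ is empty, it specifies a priority function $P_i:\mathcal U\to\mathbb R$, receives an item $x_i$ of the remaining input $X$ maximizing $P_i$ (ties broken adversarially), which is removed from $X$, reads zero or more further advice bits, and makes an irrevocable decision $d_i$. The decision and the number of bits read are functions of the items received, the advice read and the decisions made so far. Advice used is the number of bits read. *Oblivious priority function model*: $P_i$ may depend on $x_1,\dots,x_{i-1}$ and the advice read so far, but must give the same priority to all input items that are indistinguishable when ignoring names not present in the items already received (e.g., for unweighted graph problems, vertices of the same degree where neither the vertices nor their neighbors have been seen yet get the same priority). **Problem $B$.** A decision (''accept'' or ''reject'') is made for every input item. The objective function assigns to the input items and decisions a value in $\mathbb R\cup\{\pm\infty\}$ ($\pm\infty$ for infeasibility) and is invariant under simultaneous permutation of items and decisions. The approximation ratio of an algorithm for a maximization problem is the worst case over inputs of the optimal value divided by the algorithm's objective value (so ratios are at least $1$). **Gadgets.** A *gadget* for $B$ is a constant-sized instance of $B$, i.e., a collection of input items satisfying the consistency conditions for $B$ (the conditions for a collection of items to be a valid input; e.g., for a graph problem where an item is a vertex name with a list of neighbor names, $u$ is listed as a neighbor of $v$ iff $v$ is listed as a neighbor of $u$). A *gadget pattern* is a gadget up to renaming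 of the names occurring in it; a *gadget pattern pair* is a pair $(G^a,G^r)$ of gadget patterns. A *subuniverse* for a collection of gadget pattern pairs is a set of input items over its own set of names containing all input items needed for all isomorphic (renamed) copies of all gadget patterns in the collection. Inputs consist of one gadget, consistent with one of the gadget patterns, from each of the subuniverses. - *Consistency condition*: the chosen input items form valid instances of $B$. - *Disjoint copies condition*: the subuniverses are pairwise disjoint and identical up to renaming, so an input item identifies the subuniverse it is in. - *Additivity with respect to the gadgets*: for any instance formed from a set of gadgets from disjoint subuniverses, the objective value on the instance is the sum of the objective values on the individual gadgets. - *First item condition*: the first input item $\mathit{first}(\mathcal U_i)$ that the algorithm receives from a subuniverse $\mathcal U_i$ identifies a gadget pattern pair $(G^a,G^r)$ of the collection, and the item itself gives no information about which of the two patterns it is in (i.e., for the current priority function $P$, it can be the highest-priority item both in a copy of $G^a$ and in a copy of $G^r$ in $\mathcal U_i$). - *Distinguishing decision condition*: the decision on this first item resulting in the optimal objective value in $G^a$ is different from the decision resulting in the optimal objective value in $G^r$; the optimal decision is ''accept'' for $G^a$ and ''reject'' for $G^r$. $\mathrm{OPT}(G)$ is the best objective value on $G$. $\mathrm{BAD}(G)$ is the best objective value attainable on $G$ after making the wrong (non-optimal) decision on the first item of $G$ presented to the algorithm. *)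

(* Defs.v *)
From mathcomp Require Import all_boot all_order all_algebra.
From mathcomp Require Import all_classical all_reals all_analysis.

Set Implicit Arguments.
Unset Strict Implicit.
Unset Printing Implicit Defensive.

Import Order.TTheory GRing.Theory Num.Theory.
Local Open Scope classical_set_scope.
Local Open Scope ring_scope.

Definition entropy (R : realType) (p : R) : R :=
  - (p * (ln p / ln 2)) - (1 - p) * (ln (1 - p) / ln 2).

(* Multisets are represented by lists up to [perm_eq]; for decisions, [true]
   means "accept".  Items form a nominal set: each mentions finitely many names
   and can be renamed along bijections of the names.  Names carry no meaning
   for the problem itself, which is what makes validity and objective value
   well defined on gadgets "up to renaming". *)
Record problem (R : realType) := Problem {
  name : eqType;
  item : eqType;
  names_of : item -> seq name;
  rename : (name -> name) -> item -> item;
  rename_id : forall x, rename id x = x;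
  rename_comp : forall f g x, bijective f -> bijective g ->
    rename (f \o g) x = rename f (rename g x);
  rename_local : forall f g x, bijective f -> bijective g ->
    {in names_of x, f =1 g} -> rename f x = rename g x;
  names_of_rename : forall f x, bijective f ->
    names_of (rename f x) =i map f (names_of x);
  valid : seq item -> Prop;
  valid_perm : forall X Y, perm_eq X Y -> valid X -> valid Y;
  valid_rename : forall f X, bijective f -> valid X -> valid (map (rename f) X);
  obj : seq (item * bool) -> \bar R;
  obj_perm : forall D E, perm_eq D E -> obj D = obj E;
  obj_rename : forall f D, bijective f ->
    obj [seq (rename f xd.1, xd.2) | xd <- D] = obj D }.

Arguments name {R} p.
Arguments item {R} p.
Arguments names_of {R p} x.
Arguments rename {R p} f x.
Arguments valid {R p} X.
Arguments obj {R p} D.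

Definition opt (R : realType) (B : problem R) (X : seq (item B)) : \bar R :=
  ereal_sup [set obj D | D in [set D : seq (item B * bool) | unzip1 D = X]].

(* best value on [X] when one occurrence of [x] receives decision [d] *)
Definition opt_with (R : realType) (B : problem R)
    (X : seq (item B)) (x : item B) (d : bool) : \bar R :=
  ereal_sup [set obj ((x, d) :: D) | D in
    [set D : seq (item B * bool) | perm_eq (x :: unzip1 D) X]].

(* optimal value over obtained value; unbounded if the latter is not positive *)
Definition value_ratio (R : realType) (o v : \bar R) : \bar R :=
  (if 0 < v then o / v else +oo)%E.

(* History: items received with their decisions, in order of arrival.  The
   functions [read_*] tell, given the advice read so far, whether to read one
   more bit before the first iteration, resp. between the arrival of an item
   and the decision on it.  [priority] is given the history and the advice. *)
Record algorithm (R : realType) (B : problem R) := Algorithm {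
  read_init : seq bool -> bool;
  read_next : seq (item B * bool) -> item B -> seq bool -> bool;
  priority : seq (item B * bool) -> seq bool -> item B -> R;
  decide : seq (item B * bool) -> item B -> seq bool -> bool }.

Definition highest (R : realType) (B : problem R) (P : item B -> R)
    (X : seq (item B)) (x : item B) : Prop :=
  x \in X /\ forall y, y \in X -> P y <= P x.

(* An adversarial tie-breaking strategy: it sees the current priority function,
   the history and the remaining input. *)
Definition strategy (R : realType) (B : problem R) : Type :=
  (item B -> R) -> seq (item B * bool) -> seq (item B) -> item B.

Definition tie_breaking (R : realType) (B : problem R) (tb : strategy B) : Prop :=
  forall P h Y, Y != [::] -> highest P Y (tb P h Y).

(* starting with [w] bits read, reading stops with [w'] bits read *)
Definition reads (more : seq bool -> bool) (tape : nat -> bool) (w w' : nat) : Prop :=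
  [/\ (w <= w')%N,
      forall l, (w <= l < w')%N -> more (mkseq tape l)
    & ~~ more (mkseq tape w')].

(* [reach A tb tape X Y h w]: at the start of some iteration on input [X], the
   remaining input is [Y], the history is [h] and [w] bits have been read. *)
Inductive reach (R : realType) (B : problem R) (A : algorithm B)
    (tb : strategy B) (tape : nat -> bool) (X : seq (item B)) :
    seq (item B) -> seq (item B * bool) -> nat -> Prop :=
| reach_init w : reads (read_init A) tape 0 w -> reach A tb tape X X [::] w
| reach_next Y h w x w' :
    reach A tb tape X Y h w -> Y != [::] ->
    x = tb (priority A h (mkseq tape w)) h Y ->
    reads (read_next A h x) tape w w' ->
    reach A tb tape X (rem x Y) (rcons h (x, decide A h x (mkseq tape w'))) w'.

Definition run (R : realType) (B : problem R) (A : algorithm B)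
    (tb : strategy B) (tape : nat -> bool) (X : seq (item B))
    (out : seq (item B * bool)) (w : nat) : Prop :=
  reach A tb tape X [::] out w.

(* [k] gadget pattern pairs are given by representatives
   [G : 'I_k -> bool -> seq (item B)]: [G j true] stands for G_j^a and
   [G j false] for G_j^r, so that the boolean is the decision meant to be
   optimal on the first item. *)

Definition copy_in (R : realType) (B : problem R) (V : set (item B))
    (G0 g : seq (item B)) : Prop :=
  (exists2 f : name B -> name B, bijective f & perm_eq g (map (rename f) G0)) /\
  (forall x, x \in g -> V x).

Definition gadget_in (R : realType) (B : problem R) (k : nat)
    (G : 'I_k -> bool -> seq (item B)) (V : set (item B)) (g : seq (item B)) : Prop :=
  exists j c, copy_in V (G j c) g.

(* [V] is a subuniverse over the set of names [N], which is large enough to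
   host every pattern *)
Definition subuniverse (R : realType) (B : problem R) (k : nat)
    (G : 'I_k -> bool -> seq (item B)) (N : set (name B)) (V : set (item B)) : Prop :=
  [/\ forall x, V x -> [set` names_of x] `<=` N,
      forall j c (f : name B -> name B), bijective f ->
        (forall x, x \in G j c -> [set` names_of (rename f x)] `<=` N) ->
        forall x, x \in G j c -> V (rename f x)
    & forall j c, exists g, copy_in V (G j c) g].

Definition disjoint_copies (R : realType) (B : problem R) (m : nat)
    (N : 'I_m -> set (name B)) (U : 'I_m -> set (item B)) : Prop :=
  forall i l, i != l ->
    [/\ N i `&` N l = set0, U i `&` U l = set0
      & exists2 f : name B -> name B, bijective f & U l = rename f @` U i].

Definition consistency (R : realType) (B : problem R) (k m : nat)
    (G : 'I_k -> bool -> seq (item B)) (U : 'I_m -> set (item B)) : Prop :=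
  forall g : 'I_m -> seq (item B), (forall i, gadget_in G (U i) (g i)) ->
    valid (flatten [seq g i | i <- enum 'I_m]).

Definition additivity (R : realType) (B : problem R) (k m : nat)
    (G : 'I_k -> bool -> seq (item B)) (U : 'I_m -> set (item B)) : Prop :=
  forall D : 'I_m -> seq (item B * bool),
    (forall i, gadget_in G (U i) (unzip1 (D i))) ->
    obj (flatten [seq D i | i <- enum 'I_m]) = (\sum_(i < m) obj (D i))%E.

Definition input (R : realType) (B : problem R) (k m : nat)
    (G : 'I_k -> bool -> seq (item B)) (U : 'I_m -> set (item B))
    (X : seq (item B)) : Prop :=
  valid X /\
  exists2 g : 'I_m -> seq (item B), forall i, gadget_in G (U i) (g i)
    & perm_eq X (flatten [seq g i | i <- enum 'I_m]).

(* After history [h] on input [X], [A] uses the priority function [P]. *)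
Definition current (R : realType) (B : problem R) (k m : nat)
    (G : 'I_k -> bool -> seq (item B)) (U : 'I_m -> set (item B))
    (A : algorithm B) (X : seq (item B)) (h : seq (item B * bool))
    (P : item B -> R) : Prop :=
  exists tb tape Y w,
    [/\ input G U X, tie_breaking tb, reach A tb tape X Y h w, Y != [::]
      & P = priority A h (mkseq tape w)].

(* Two items are indistinguishable, when ignoring names not seen so far, if one
   is a renaming of the other that fixes every name seen so far. *)
Definition oblivious (R : realType) (B : problem R) (k m : nat)
    (G : 'I_k -> bool -> seq (item B)) (U : 'I_m -> set (item B))
    (A : algorithm B) : Prop :=
  forall X h P, current G U A X h P ->
  forall (f : name B -> name B) x, bijective f ->
    (forall y n, y \in unzip1 h -> n \in names_of y -> f n = n) ->
    (exists i, U i x) -> (exists i, U i (rename f x)) ->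
    P (rename f x) = P x.

(* [A] uses the priority function [P] at a time when it has received no item of
   [U i] yet, on an input whose gadget from [U i] is from the [j]-th pair. *)
Definition awaiting (R : realType) (B : problem R) (k m : nat)
    (G : 'I_k -> bool -> seq (item B)) (U : 'I_m -> set (item B))
    (A : algorithm B) (P : item B -> R) (i : 'I_m) (j : 'I_k) : Prop :=
  exists X h,
    [/\ current G U A X h P,
        forall y, y \in unzip1 h -> ~ U i y
      & exists c, copy_in (U i) (G j c) [seq x <- X | x \in U i]].

(* Ties being broken adversarially, the first item received from [U i] under
   [P] is an adversary's choice [first P i j], made together with copies
   [cpy P i j true] of G_j^a and [cpy P i j false] of G_j^r in [U i] in both of
   which this item can be the first one. *)
Definition first_item_condition (R : realType) (B : problem R) (k m : nat)
    (G : 'I_k -> bool -> seq (item B)) (U : 'I_m -> set (item B))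
    (A : algorithm B) (first : (item B -> R) -> 'I_m -> 'I_k -> item B)
    (cpy : (item B -> R) -> 'I_m -> 'I_k -> bool -> seq (item B)) : Prop :=
  exists identified_pair : item B -> 'I_k,
  forall P i j, awaiting G U A P i j ->
    identified_pair (first P i j) = j /\
    forall c, copy_in (U i) (G j c) (cpy P i j c) /\
              highest P (cpy P i j c) (first P i j).

Definition distinguishing_decision_condition (R : realType) (B : problem R)
    (k m : nat) (G : 'I_k -> bool -> seq (item B)) (U : 'I_m -> set (item B))
    (A : algorithm B) (first : (item B -> R) -> 'I_m -> 'I_k -> item B)
    (cpy : (item B -> R) -> 'I_m -> 'I_k -> bool -> seq (item B)) : Prop :=
  forall P i j, awaiting G U A P i j ->
  forall c d,
    opt_with (cpy P i j c) (first P i j) d = opt (cpy P i j c) <-> d = c.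

(* BAD(G_j^a) for [c = true] and BAD(G_j^r) for [c = false] *)
Definition bad (R : realType) (B : problem R) (k m : nat)
    (G : 'I_k -> bool -> seq (item B)) (U : 'I_m -> set (item B))
    (A : algorithm B) (first : (item B -> R) -> 'I_m -> 'I_k -> item B)
    (cpy : (item B -> R) -> 'I_m -> 'I_k -> bool -> seq (item B))
    (j : 'I_k) (c : bool) : \bar R :=
  ereal_sup [set v | exists P i, awaiting G U A P i j /\
    v = opt_with (cpy P i j c) (first P i j) (~~ c)].

Definition max_size (R : realType) (B : problem R) (k : nat)
    (G : 'I_k -> bool -> seq (item B)) : nat :=
  \max_(j < k) maxn (size (G j true)) (size (G j false)).

(* the oracle knows the input and how ties will be broken *)
Definition oracle (R : realType) (B : problem R) : Type :=
  seq (item B) -> strategy B -> nat -> bool.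

Definition advice_less_than (R : realType) (B : problem R) (k m : nat)
    (G : 'I_k -> bool -> seq (item B)) (U : 'I_m -> set (item B))
    (A : algorithm B) (phi : oracle B) (bound : nat -> R) : Prop :=
  forall X tb, input G U X -> tie_breaking tb ->
    exists out w, run A tb (phi X tb) X out w /\ w%:R < bound (size X).

Definition approximation_ratio (R : realType) (B : problem R) (k m : nat)
    (G : 'I_k -> bool -> seq (item B)) (U : 'I_m -> set (item B))
    (A : algorithm B) (phi : oracle B) : \bar R :=
  ereal_sup [set r | exists X tb out w,
    [/\ input G U X, tie_breaking tb, run A tb (phi X tb) X out w
      & r = value_ratio (opt X) (obj out)]].

(* Main.v *)
Require Import Defs.
From mathcomp Require Import all_boot all_order all_algebra.
From mathcomp Require Import fingroup perm ring lra.
From mathcomp Require Import all_classical all_reals all_analysis.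
Set Implicit Arguments.
Unset Strict Implicit.
Unset Printing Implicit Defensive.
Import Order.TTheory GRing.Theory Num.Theory.
Local Open Scope classical_set_scope.
Local Open Scope ring_scope.

(* Fix one pattern pair.  In each subuniverse take one copy of its accept and one
   of its reject pattern on a common finite set of n names; an instance omega
   chooses, for each subuniverse, one of the two and a permutation of these
   names.  By obliviousness the highest priority within a subuniverse not seen
   so far depends neither on the choice nor on the permutation, and ties can be
   broken so that the first item received from it is the permuted image of a
   fixed item of the chosen copy.  The fixed items of the two copies are
   renamings of each other, so under a uniform permutation their images have
   the same distribution: the item received carries no information.  Hence for
   a fixed advice tape the average of z ^ (number of mistakes) over all
   instances is at most ((1 + z) / 2) ^ m.  Summing over the 2 ^ b advice strings,
   with z = eps / (1 - eps), some instance forces at least eps * m mistakes.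
   The random renaming is needed because the advice may steer the priority
   function, and thereby which item comes first, so no two fixed copies look
   alike for all tapes. *)

(** * Bijections of names and reordering of lists *)

(** Built by composing with at most one transposition per element of [s]. That [f'] moves nothing
    outside [s] and its image is what obliviousness will ask of a renaming: names already seen must
    stay fixed. *)
Lemma bij_extension (T : eqType) (s : seq T) (f : T -> T) : injective f ->
  exists f', [/\ bijective f', {in s, f' =1 f}
    & forall x, x \notin s -> x \notin map f s -> f' x = x].
Proof.
move=> f_inj; elim: s => [|a s [f' [f'_bij f's f'id]]].
  by exists id; split=> //; exists id.
have f'_inj := bij_inj f'_bij.
have [as_|as_] := boolP (a \in s).
  exists f'; split=> // [x|x].
    by rewrite inE => /predU1P[->|]; apply: f's.
  by rewrite !inE !negb_or => /andP[_ xs] /andP[_ xfs]; apply: f'id.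
pose sw x := if x == f' a then f a else if x == f a then f' a else x.
have swK : involutive sw.
  move=> x; rewrite /sw; have [->|xa] := eqVneq x (f' a).
    by rewrite eqxx; case: eqVneq => // ->.
  have [->|xb] := eqVneq x (f a); first by rewrite eqxx.
  by rewrite (negPf xa) (negPf xb).
exists (sw \o f'); split=> [|x|x].
- by apply: bij_comp => //; exists sw.
- rewrite inE => /predU1P[->|xs] /=; rewrite /sw ?eqxx //.
  have xa : x != a by apply: contraNneq as_ => <-.
  by rewrite (inj_eq f'_inj) (negPf xa) f's// (inj_eq f_inj) (negPf xa).
- rewrite !inE !negb_or => /andP[xa xs] /andP[xfa xfs] /=.
  have f'x := f'id x xs xfs.
  by rewrite /sw (inj_eq f'_inj) (negPf xa) f'x (negPf xfa).
Qed.

Lemma perm_eq_mapP (S T : eqType) (f : S -> T) (s : seq S) (t : seq T) :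
  perm_eq (map f s) t -> exists2 s', perm_eq s s' & map f s' = t.
Proof.
elim: t s => [|y t IH] s st.
  exists [::] => //; move/perm_nilP: st.
  by case: s.
have /mapP[x xs yx] : y \in map f s by rewrite (perm_mem st) mem_head.
have st' : perm_eq (map f (rem x s)) t.
  have := perm_map f (perm_to_rem xs); rewrite perm_sym => p.
  by have := perm_trans p st; rewrite /= yx perm_cons.
have [s' ss' fs'] := IH _ st'.
exists (x :: s'); last by rewrite /= fs' yx.
by rewrite (permPl (perm_to_rem xs)) perm_cons.
Qed.

Lemma mem_neq0 (T : eqType) (s : seq T) : s != [::] -> exists x, x \in s.
Proof. by case: s => // x s _; exists x; rewrite mem_head. Qed.

Lemma head_filter (T : eqType) (x0 : T) (a : pred T) (s : seq T) : has a s ->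
  a (head x0 [seq x <- s | a x]) && (head x0 [seq x <- s | a x] \in s).
Proof.
elim: s => //= y s IH; rewrite inE; case: ifP => /= [->|_ /IH/andP[-> ->]].
  by rewrite eqxx.
by rewrite orbT.
Qed.

(** * Objective values under reordering and renaming *)

Section Values.
Variables (R : realType) (B : problem R).
Implicit Types (X Y : seq (item B)) (D : seq (item B * bool)) (x : item B).

Lemma renameK f g x : bijective f -> bijective g -> cancel f g ->
  rename g (rename f x) = x.
Proof.
move=> fb gb fg; rewrite -(rename_comp _ gb fb) -[RHS]rename_id.
by congr (rename _ x); apply/funext => n /=.
Qed.

Lemma opt_perm X Y : perm_eq X Y -> opt X = opt Y.
Proof.
suff le X' Y' : perm_eq X' Y' -> (opt X' <= opt Y')%E.
  by move=> XY; apply/eqP; rewrite eq_le !le// perm_sym.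
move=> XY; apply: ge_ereal_sup => _ [D /= DX <-].
rewrite -DX in XY; have [D' DD' D'Y] := perm_eq_mapP XY.
rewrite (obj_perm DD'); apply: ereal_sup_ubound; by exists D'.
Qed.

Lemma obj_le_opt D X : perm_eq (unzip1 D) X -> (obj D <= opt X)%E.
Proof.
by move=> DX; rewrite -(opt_perm DX); apply: ereal_sup_ubound; exists D.
Qed.

Lemma obj_le_opt_with D X x d : perm_eq (x :: unzip1 D) X ->
  (obj ((x, d) :: D) <= opt_with X x d)%E.
Proof. by move=> DX; apply: ereal_sup_ubound; exists D. Qed.

Lemma opt_with_le_opt X x d : (opt_with X x d <= opt X)%E.
Proof.
apply: ge_ereal_sup => _ [D /= DX <-]; exact: obj_le_opt.
Qed.

Lemma opt_with_perm X Y x d : perm_eq X Y -> opt_with X x d = opt_with Y x d.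
Proof.
move=> XY; congr ereal_sup; apply/seteqP; split => _ [D /= DX <-];
  exists D => //=; [exact: perm_trans XY|].
by apply: perm_trans DX _; rewrite perm_sym.
Qed.

Let ren f D := [seq (rename f xd.1, xd.2) | xd <- D].

Let unzip1_ren f D : unzip1 (ren f D) = map (rename f) (unzip1 D).
Proof. by rewrite /unzip1 /ren -!map_comp. Qed.

Lemma opt_rename f X : bijective f -> opt (map (rename f) X) = opt X.
Proof.
suff le (h : name B -> name B) (Z : seq (item B)) :
    bijective h -> (opt (map (rename h) Z) <= opt Z)%E.
  move=> fb; have [g fg gf] := fb; have gb : bijective g by exists f.
  apply/eqP; rewrite eq_le le//=.
  have := le g (map (rename f) X) gb.
  by rewrite -map_comp (eq_map (fun x => renameK x fb gb fg)) map_id.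
move=> hb; have [g hg gh] := hb; have gb : bijective g by exists h.
apply: ge_ereal_sup => _ [D /= DX <-].
rewrite -(obj_rename D gb); apply: obj_le_opt; rewrite unzip1_ren DX.
by rewrite -map_comp (eq_map (fun x => renameK x hb gb hg)) map_id.
Qed.

Lemma opt_with_rename f X x d : bijective f ->
  opt_with (map (rename f) X) (rename f x) d = opt_with X x d.
Proof.
suff le (h : name B -> name B) (Z : seq (item B)) (y : item B) :
    bijective h ->
    (opt_with (map (rename h) Z) (rename h y) d <= opt_with Z y d)%E.
  move=> fb; have [g fg gf] := fb; have gb : bijective g by exists f.
  apply/eqP; rewrite eq_le le//=.
  have := le g (map (rename f) X) (rename f x) gb.
  rewrite -map_comp (eq_map (fun x => renameK x fb gb fg)) map_id.
  by rewrite renameK.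
move=> hb; have [g hg gh] := hb; have gb : bijective g by exists h.
apply: ge_ereal_sup => _ [D /= DX <-].
rewrite -(obj_rename _ gb) /= renameK//; apply: obj_le_opt_with.
have := perm_map (rename g) DX; rewrite /= renameK// unzip1_ren.
by rewrite -map_comp (eq_map (fun x => renameK x hb gb hg)) map_id.
Qed.

Lemma opt_copy_in V X Y : copy_in V X Y -> opt Y = opt X.
Proof. by move=> [[f fb /opt_perm->] _]; apply: opt_rename. Qed.

(** There are finitely many decision tuples for [X], so the supremum is a maximum. A solution of a
    whole instance can then be assembled from optimal solutions of its gadgets. *)
Lemma opt_attained X : exists2 D, unzip1 D = X & obj D = opt X.
Proof.
pose F (d : (size X).-tuple bool) := obj (zip X d).
have [d _ dmax] := @arg_maxP _ _ _ [tuple of nseq (size X) true] predT F isT.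
have unzipX (e : (size X).-tuple bool) : unzip1 (zip X e) = X.
  by rewrite unzip1_zip// size_tuple.
exists (zip X d) => //; apply/eqP; rewrite eq_le obj_le_opt ?unzipX//=.
apply: ge_ereal_sup => _ [D /= DX <-].
have sz : size (unzip2 D) == size X by rewrite -DX !size_map.
rewrite -(zip_unzip D) DX; exact: (dmax (Tuple sz)).
Qed.

End Values.

(** * Runs of an algorithm: determinism and finite use of the tape *)

Section Runs.
Variables (R : realType) (B : problem R) (A : algorithm B) (tb : strategy B).
Implicit Types (tape : nat -> bool) (X Y : seq (item B)).
Implicit Types (h : seq (item B * bool)) (w : nat).

Lemma reads_uniq more tape w w1 w2 :
  reads more tape w w1 -> reads more tape w w2 -> w1 = w2.
Proof.
move=> [le1 m1 n1] [le2 m2 n2].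
case: (ltngtP w1 w2) => // lt.
- by move: n1; rewrite m2// le1.
- by move: n2; rewrite m1// le2.
Qed.

Lemma eq_reads more t t' w w' : {in gtn w', t =1 t'} ->
  reads more t w w' -> reads more t' w w'.
Proof.
have eq_mk l : {in gtn l, t =1 t'} -> mkseq t l = mkseq t' l.
  by move=> e; apply/eq_in_map => i; rewrite mem_iota => /= il; apply: e.
move=> e [le m n]; split=> // [l lw|]; last by rewrite -eq_mk.
rewrite -eq_mk; first exact: m.
by move=> i il; apply: e; case/andP: lw => _; apply: ltn_trans.
Qed.

(** A run that has read [w] bits cannot depend on later ones. This is why finitely many tapes, one
    per advice string of bounded length, can stand for all oracle tapes. *)
Lemma eq_reach t t' X Y h w : {in gtn w, t =1 t'} ->
  reach A tb t X Y h w -> reach A tb t' X Y h w.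
Proof.
move=> e r; elim: r e => {Y h w} [w r|Y h w x w' _ IH Y0 -> r] e.
  by apply: reach_init; apply: eq_reads r.
have eq_mk l : (l <= w')%N -> mkseq t l = mkseq t' l.
  move=> lw; apply/eq_in_map => i; rewrite mem_iota => /= il; apply: e.
  exact: leq_trans lw.
have ww' : (w <= w')%N by case: r.
rewrite !eq_mk//; apply: (reach_next _ Y0) => //.
  by apply: IH => i iw; apply: e; exact: leq_trans ww'.
by rewrite eq_mk// in r; exact: eq_reads r.
Qed.

(** The length of the history numbers the iterations, so equal lengths mean the same point of the
    one run on this tape. *)
Lemma reach_det t X Y1 h1 w1 Y2 h2 w2 :
  reach A tb t X Y1 h1 w1 -> reach A tb t X Y2 h2 w2 -> size h1 = size h2 ->
  [/\ Y1 = Y2, h1 = h2 & w1 = w2].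
Proof.
move=> r1; elim: r1 Y2 h2 w2 => {Y1 h1 w1} [w1 r|Y h w x w' _ IH Y0 -> r] Y2 h2 w2.
  case=> [w2' r' _|Y' h' w' x' w2' _ _ _ _]; last by rewrite size_rcons.
  by split=> //; exact: reads_uniq r r'.
case=> [?|Y' h' w'' x' w2' r' Y0' -> rd]; rewrite !size_rcons//.
case=> sz; have [eY eh ew] := IH _ _ _ r' sz; subst.
by have <- := reads_uniq r rd.
Qed.

Lemma reach_prefix t X Y h w n : reach A tb t X Y h w -> (n <= size h)%N ->
  exists Y' w', reach A tb t X Y' (take n h) w'.
Proof.
move=> r; elim: r n => {Y h w} [w r|Y h w x w' r IH Y0 xE rd] n nh.
  by exists X, w; apply: reach_init.
move: nh; rewrite size_rcons leq_eqVlt ltnS => /predU1P[->|nh].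
  rewrite take_oversize ?size_rcons//; exists (rem x Y), w'.
  exact: reach_next rd.
have [Y' [w'' r']] := IH n nh; exists Y', w''.
by rewrite -cats1 takel_cat.
Qed.

Lemma reach_last t X Y h w : reach A tb t X Y h w -> h != [::] ->
  exists Y0 h0 w0 x, [/\ reach A tb t X Y0 h0 w0, Y0 != [::],
    x = tb (priority A h0 (mkseq t w0)) h0 Y0,
    reads (read_next A h0 x) t w0 w &
    h = rcons h0 (x, decide A h0 x (mkseq t w))].
Proof.
by case=> // Y0 h0 w0 x w' r Y00 xE rd _; exists Y0, h0, w0, x.
Qed.

Lemma reach_nil t X Y w : reach A tb t X Y [::] w -> reads (read_init A) t 0 w.
Proof.
suff aux h : reach A tb t X Y h w -> h = [::] -> reads (read_init A) t 0 w.
  by move=> r; exact: aux r erefl.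
by case=> // Y' h' w' x w'' _ _ _ _; case: h'.
Qed.

Hypothesis tbP : tie_breaking tb.

Lemma reach_perm t X Y h w : reach A tb t X Y h w ->
  perm_eq (Y ++ unzip1 h) X.
Proof.
elim=> {Y h w} [w r|Y h w x w' r IH Y0 xE rd]; first by rewrite cats0.
apply: perm_trans IH.
have xY : x \in Y by rewrite xE; case: (tbP (priority A h (mkseq t w)) h Y0).
rewrite /unzip1 map_rcons -cats1 /= catA perm_catC /= -cat_cons perm_cat2r.
by rewrite perm_sym perm_to_rem.
Qed.

Lemma reach_size t X Y h w : reach A tb t X Y h w ->
  (size Y + size h = size X)%N.
Proof. by move/reach_perm/perm_size; rewrite size_cat size_map. Qed.

End Runs.

(** * Permutations of a finite list of names *)

Section PermAct.
Variables (T : eqType) (n : nat) (S : seq T).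
Hypotheses (S_uniq : uniq S) (S_size : size S = n).
Implicit Types (s u : 'S_n) (x : T).

(** Indexing by ['S_n] rather than by permutations of [S] itself makes the random renamings in all
    subuniverses range over the same finite group. *)
Definition act s x : T :=
  if insub (index x S) is Some i then nth x S (s i) else x.

Lemma act_notin s x : x \notin S -> act s x = x.
Proof.
by move=> xS; rewrite /act insubF// -S_size index_mem (negPf xS).
Qed.

Lemma act_nth s x (i : 'I_n) : act s (nth x S i) = nth x S (s i).
Proof.
rewrite /act index_uniq ?S_size//= valK.
by apply: set_nth_default; rewrite S_size.
Qed.

Lemma mem_nthP x : x \in S -> exists i : 'I_n, x = nth x S i.
Proof.
move=> xS; have lt : (index x S < n)%N by rewrite -S_size index_mem.
by exists (Ordinal lt); rewrite /= nth_index.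
Qed.

Lemma act_mem s x : x \in S -> act s x \in S.
Proof.
by move=> /mem_nthP[i ->]; rewrite act_nth mem_nth// S_size.
Qed.

Lemma actM s u x : act (s * u)%g x = act u (act s x).
Proof.
have [/mem_nthP[i ->]|xS] := boolP (x \in S); last by rewrite !act_notin.
by rewrite !act_nth permM.
Qed.

Lemma act1 x : act 1%g x = x.
Proof.
have [/mem_nthP[i xE]|xS] := boolP (x \in S); last by rewrite !act_notin.
by rewrite {1}xE act_nth perm1 -xE.
Qed.

Lemma act_bij s : bijective (act s).
Proof.
by exists (act s^-1%g) => x; rewrite -actM ?mulgV ?mulVg act1.
Qed.

Lemma act_extension (f : T -> T) (s : seq T) : injective f ->
  {subset s <= S} -> {subset map f s <= S} ->
  exists p : 'S_n, {in s, act p =1 f}.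
Proof.
move=> f_inj sS fsS; have [f' [f'_bij f's f'id]] := bij_extension s f_inj.
(* If [f' x] were outside [S], it would be outside [s] and its image, hence fixed by [f'];
   injectivity then gives [f' x = x], which is in [S]. *)
have f'S x : x \in S -> f' x \in S.
  move=> xS; have [//|f'xS] := boolP (f' x \in S).
  suff : f' (f' x) = f' x by move/(bij_inj f'_bij) => e; rewrite e xS in f'xS.
  by apply: f'id; apply: contraNN f'xS; [exact: sS|exact: fsS].
have lt x (i : 'I_n) : (index (f' (nth x S i)) S < n)%N.
  have : (index (f' (nth x S i)) S < size S)%N.
    by rewrite index_mem f'S// mem_nth// S_size.
  by rewrite S_size.
case: s => [|x0 s] in sS fsS f's f'id *; first by exists 1%g.
pose F (i : 'I_n) : 'I_n := Ordinal (lt x0 i).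
have F_inj : injective F.
  move=> i j [e]; apply/val_inj/eqP => /=.
  rewrite -(nth_uniq x0 _ _ S_uniq) ?S_size//; apply/eqP.
  apply: (bij_inj f'_bij).
  by have := congr1 (nth x0 S) e; rewrite !nth_index// f'S// mem_nth// S_size.
exists (perm F_inj) => x xs; have /mem_nthP[i xE] := sS _ xs.
rewrite -f's// xE act_nth permE /= nth_index.
  by rewrite (set_nth_default x) ?S_size// -xE.
by rewrite f'S// mem_nth// S_size.
Qed.

End PermAct.

(** * Real inequalities behind the final bound *)

Lemma powR_le_exprn (R : realType) (z x : R) (n : nat) :
  0 < z -> z <= 1 -> n%:R <= x -> z `^ x <= z ^+ n.
Proof.
move=> z0 z1 nx; rewrite -powR_mulrn ?(ltW z0)// /powR (negPf (lt0r_neq0 z0)).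
by rewrite ler_expR ler_wnM2r// ln_le0.
Qed.

(* The value eps / (1 - eps) of z makes (1 + z) / z ^ eps equal to 2 ^ (entropy eps). *)
Lemma entropy_bound (R : realType) (eps K : R) (m b : nat) (z := eps / (1 - eps)) :
  0 < eps -> eps < 1 -> 0 < K ->
  (2 * K) ^+ m * z `^ (eps * m%:R) <= 2 ^+ b * (K * (1 + z)) ^+ m ->
  (1 - entropy eps) * m%:R <= b%:R.
Proof.
move=> e0 e1 K0 le.
have e1' : 0 < 1 - eps by rewrite subr_gt0.
have z0 : 0 < z by exact: divr_gt0.
have ln2 : 0 < ln 2 :> R by rewrite ln_gt0// ltr1n.
have z1E : 1 + z = (1 - eps)^-1 by rewrite /z; field; rewrite gt_eqF.
have lnz1 : ln (1 + z) = - ln (1 - eps) by rewrite z1E lnV.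
have lnz : ln z = ln eps - ln (1 - eps) by rewrite ln_div.
have z10 : 0 < 1 + z by rewrite addr_gt0.
(* Logarithms make the inequality linear; the terms in [ln K] on both sides cancel. *)
move: le; rewrite -ler_ln ?posrE ?mulr_gt0 ?exprn_gt0 ?powR_gt0 ?mulr_gt0 ?invr_gt0//.
rewrite !lnM ?posrE ?exprn_gt0 ?powR_gt0 ?mulr_gt0 ?invr_gt0//.
rewrite ln_powR !lnXn ?mulr_gt0//.
rewrite (lnM _ _ : ln (2 * K) = _) ?posrE//.
rewrite (lnM _ _ : ln (K * (1 + z)) = _) ?posrE//.
rewrite lnz1 lnz -(mulr_natr (ln 2)) -!(mulr_natr (_ + _)) => le.
rewrite -(ler_pM2r ln2) /entropy; move: (ln 2) (ln K) (ln eps) (ln (1 - eps)) ln2 le.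
move: (m%:R : R) (b%:R : R) {e0 e1 e1' z0 z1E lnz1 lnz z10 z K0}.
move=> M N l2 lK le l1 l2_gt0 H.
have -> : (1 - (- (eps * (le / l2)) - (1 - eps) * (l1 / l2))) * M * l2 =
   (l2 + eps * le + (1 - eps) * l1) * M by field; rewrite gt_eqF.
rewrite -subr_ge0; rewrite -subr_ge0 in H; apply: le_trans H _.
by rewrite le_eqVlt; apply/orP; left; apply/eqP; ring.
Qed.

(* T is the total optimum, L the part of it due to the gadgets with a mistake. *)
Lemma ratio_bound (R : realType) (a r rho eps T L : R) :
  0 < a -> a <= r -> 1 <= rho -> 0 < eps -> eps < 1 -> 0 <= L -> L <= T ->
  eps * a * (T - L) <= (1 - eps) * r * L -> 0 < T - (1 - rho^-1) * L ->
  1 + eps * (rho - 1) * a / (eps * a + (1 - eps) * rho * r) <=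
  T / (T - (1 - rho^-1) * L).
Proof.
move=> a0 ar rho1 e0 e1 L0 LT le d0.
have r0 : 0 < r by exact: lt_le_trans ar.
have rho0 : 0 < rho by exact: lt_le_trans rho1.
have e1' : 0 < 1 - eps by rewrite subr_gt0.
have q0 : 0 < eps * a + (1 - eps) * rho * r by rewrite addr_gt0 ?mulr_gt0.
have d'0 : 0 < rho * (T - L) + L.
  have -> : rho * (T - L) + L = rho * (T - (1 - rho^-1) * L).
    by field; rewrite gt_eqF.
  exact: mulr_gt0.
have -> : T / (T - (1 - rho^-1) * L) = 1 + (rho - 1) * L / (rho * (T - L) + L).
  by field; rewrite !gt_eqF//=; rewrite (_ : _ - _ = rho * (T - L) + L)//; ring.
rewrite lerD2l ler_pdivrMr// [leRHS]mulrAC ler_pdivlMr// -subr_ge0.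
(* The difference of the cross products is the slack of the hypothesis [le] times
   [(rho - 1) * rho]. *)
rewrite [leRHS](_ : _ =
    (rho - 1) * rho * ((1 - eps) * r * L - eps * a * (T - L))); last by ring.
by rewrite !mulr_ge0 ?subr_ge0// ltW.
Qed.

(** This is where [eps <= 2^-1] enters: a weight [z] at most 1 makes [z ^+ n] nonincreasing in the
    number [n] of mistakes. *)
Lemma odds_le1 (R : realType) (eps : R) : 0 < eps -> eps <= 2^-1 ->
  [/\ eps < 1, 0 < eps / (1 - eps) & eps / (1 - eps) <= 1].
Proof.
move=> e0 e2; have e1 : eps < 1 by lra.
have e1' : 0 < 1 - eps by lra.
by split=> //; [exact: divr_gt0|rewrite ler_pdivrMr//; lra].
Qed.

Lemma value_ratio_ge (R : realType) (o v : \bar R) (T V c : R) :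
  0 <= T -> (T%:E <= o)%E -> (v <= V%:E)%E -> (0 < V -> c <= T / V) ->
  (c%:E <= value_ratio o v)%E.
Proof.
move=> T0 To vV cTV; rewrite /value_ratio; case: ifPn => [v0|_]; last exact: leey.
case: v v0 vV => [v| |//]; rewrite ?leye_eq// lte_fin lee_fin => v0 vV.
rewrite inver gt_eqF//; apply: (@le_trans _ _ (T%:E * v^-1%:E)%E); last first.
  by rewrite lee_wpmul2r// lee_fin invr_ge0 ltW.
rewrite -EFinM lee_fin; apply: le_trans (cTV (lt_le_trans v0 vV)) _.
by rewrite ler_wpM2l// lef_pV2// posrE (lt_le_trans v0).
Qed.

(** If neither bad value were positive, both ratios would be [+oo]; so finiteness of [rho] yields a
    positive one. Later this shows that the supremum in [bad] is taken over a nonempty set. *)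
Lemma bad_le_opt_div (R : realType) (O : bool -> R) (b : bool -> \bar R) (rho : R) :
  (forall c, 0 < O c) -> (forall c, (b c <= (O c)%:E)%E) ->
  rho%:E = mine (value_ratio (O true)%:E (b true))
                (value_ratio (O false)%:E (b false)) ->
  [/\ 1 <= rho, exists c, (0 < b c)%E & forall c, (b c <= (O c / rho)%:E)%E].
Proof.
move=> O0 bO rhoE.
have vr c : (0 < b c)%E -> exists2 v, 0 < v <= O c &
    b c = v%:E /\ value_ratio (O c)%:E (b c) = (O c / v)%:E.
  move=> bc; move: (bO c); rewrite /value_ratio bc.
  case: (b c) bc => [v| |//]; rewrite ?leye_eq// lte_fin lee_fin => v0 vO.
  by exists v; rewrite ?v0//; split=> //; rewrite inver gt_eqF.
have [c cE] : exists c, rho%:E = value_ratio (O c)%:E (b c).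
  by rewrite rhoE; case: leP => _; [exists true|exists false].
have bc : (0 < b c)%E by move: cE; rewrite /value_ratio; case: ifP.
have rho_le c' : (rho%:E <= value_ratio (O c')%:E (b c'))%E.
  by rewrite rhoE ge_min; case: c'; rewrite lexx ?orbT.
have rho1 : 1 <= rho.
  have [v /andP[v0 vO] [_ vE]] := vr c bc; move: cE; rewrite vE => -[->].
  by rewrite ler_pdivlMr// mul1r.
have rho0 : 0 < rho by exact: lt_le_trans rho1.
split=> // [|c']; first by exists c.
have [bc'|bc'] := ltP 0%E (b c'); last first.
  by apply: le_trans bc' _; rewrite lee_fin divr_ge0// ltW.
have [v /andP[v0 vO] [bE vE]] := vr c' bc'; have := rho_le c'.
rewrite vE bE !lee_fin => le; rewrite ler_pdivlMr//.
by move: le; rewrite ler_pdivlMr// mulrC.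
Qed.

(** * The random instances *)

Section Adversary.
Variables (R : realType) (B : problem R) (k m : nat).
Variables (G : 'I_k -> bool -> seq (item B)).
Variables (N : 'I_m -> set (name B)) (U : 'I_m -> set (item B)).
Variables (A : algorithm B) (first : (item B -> R) -> 'I_m -> 'I_k -> item B).
Variables (cpy : (item B -> R) -> 'I_m -> 'I_k -> bool -> seq (item B)).
Variables (j0 : 'I_k) (n : nat) (S : 'I_m -> seq (name B)).
Variables (g0 : 'I_m -> bool -> seq (item B)).
Variables (xc : (item B -> R) -> 'I_m -> bool -> item B) (x0 : item B).

Hypothesis subU : forall i, subuniverse G (N i) (U i).
Hypothesis cons : consistency G U.
Hypothesis disj : disjoint_copies N U.
Hypothesis obl : oblivious G U A.
Hypothesis fic : forall P i, awaiting G U A P i j0 -> forall c,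
  copy_in (U i) (G j0 c) (cpy P i j0 c) /\ highest P (cpy P i j0 c) (first P i j0).
Hypothesis S_uniq : forall i, uniq (S i).
Hypothesis S_size : forall i, size (S i) = n.
Hypothesis S_N : forall i a, a \in S i -> N i a.
Hypothesis g0_copy : forall i c, copy_in (U i) (G j0 c) (g0 i c).
Hypothesis g0_S : forall i c x, x \in g0 i c -> {subset names_of x <= S i}.
Hypothesis G_neq0 : forall c, G j0 c != [::].

(** The instances are fixed independently of [P], whereas the copy [cpy P i j0 c] varies with [P].
    So [first P i j0] is pulled back along a renaming to an item of the fixed copy [g0 i c]. *)
Definition preimage_of_first (P : item B -> R) (i : 'I_m) (c : bool) (x : item B) :=
  exists f, [/\ bijective f, perm_eq (cpy P i j0 c) (map (rename f) (g0 i c)),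
    x \in g0 i c & rename f x = first P i j0].

Hypothesis xcP : forall P i c, awaiting G U A P i j0 ->
  preimage_of_first P i c (xc P i c).

Implicit Types (omega : {ffun 'I_m -> bool * 'S_n}) (P : item B -> R).
Implicit Types (h : seq (item B * bool)) (Y : seq (item B)) (v : bool * 'S_n).
Implicit Types (x y : item B) (i : 'I_m) (t : nat -> bool).

Definition gadget i v : seq (item B) := map (rename (act (S i) v.2)) (g0 i v.1).

Definition instance omega : seq (item B) :=
  flatten [seq gadget i (omega i) | i <- enum 'I_m].

Let actb i s : bijective (act (S i) s) := act_bij (S_uniq i) (S_size i) s.

Lemma names_gadget i v x : x \in gadget i v -> {subset names_of x <= S i}.
Proof.
move=> /mapP[y yg ->] a; rewrite (names_of_rename _ (actb i v.2)) => /mapP[b by_ ->].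
by rewrite act_mem// (g0_S yg).
Qed.

(** Permuting [S i] keeps all names of the copy inside [N i], and a subuniverse contains every copy
    of a pattern on its own names. *)
Lemma gadget_copy i v : copy_in (U i) (G j0 v.1) (gadget i v).
Proof.
have [[f fb pf] _] := g0_copy i v.1.
have fab : bijective (act (S i) v.2 \o f) by apply: bij_comp => //; exact: actb.
have pg : perm_eq (gadget i v) (map (rename (act (S i) v.2 \o f)) (G j0 v.1)).
  rewrite (eq_map (fun x => rename_comp x (actb i v.2) fb)) map_comp.
  exact: perm_map.
split; first by exists (act (S i) v.2 \o f).
move=> x xg; have := xg; rewrite (perm_mem pg) => /mapP[y yG ->].
have [_ UG _] := subU i.
apply: (UG j0 v.1) => // z zG a /= az; apply: S_N.
have zg : rename (act (S i) v.2 \o f) z \in gadget i v.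
  by rewrite (perm_mem pg); apply: map_f.
exact: names_gadget zg _ az.
Qed.

Lemma gadget_sub i v x : x \in gadget i v -> U i x.
Proof. by have [_] := gadget_copy i v; apply. Qed.

Lemma gadget_neq0 i v : gadget i v != [::].
Proof.
have [[f _ /perm_size]] := gadget_copy i v.
rewrite size_map => sz _; rewrite -size_eq0 sz size_eq0; exact: G_neq0.
Qed.

Lemma gadget_gadget_in i v : gadget_in G (U i) (gadget i v).
Proof. by exists j0, v.1; exact: gadget_copy. Qed.

Lemma input_instance omega : input G U (instance omega).
Proof.
have gi i := gadget_gadget_in i (omega i).
by split; [exact: cons|exists (fun i => gadget i (omega i))].
Qed.

Lemma sub_disjoint i l x : U i x -> U l x -> i = l.
Proof.
move=> Uix Ulx; apply/eqP/negPn/negP => il.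
have [_ e _] := disj il.
by have : (U i `&` U l) x by []; rewrite e.
Qed.

Lemma names_disjoint i l a : N i a -> N l a -> i = l.
Proof.
move=> Nix Nlx; apply/eqP/negPn/negP => il.
have [e _ _] := disj il.
by have : (N i `&` N l) a by []; rewrite e.
Qed.

(** Subuniverses are disjoint, so only one block survives the filter. The map [f] lets this serve
    both for items and for items paired with decisions. *)
Lemma filter_flatten_sub (T : eqType) (F : 'I_m -> seq T) (f : T -> item B) i :
  (forall l z, z \in F l -> U l (f z)) ->
  [seq z <- flatten [seq F l | l <- enum 'I_m] | f z \in U i] = F i.
Proof.
move=> FU; rewrite filter_flatten -map_comp.
have e l : [seq z <- F l | f z \in U i] = if l == i then F l else [::].
  case: eqP => [->|/eqP li].
    by apply/all_filterP/allP => x /FU; exact: mem_set.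
  apply/eqP; rewrite -(negbK (_ == _)) -has_filter; apply/hasPn => x /FU Ulx.
  by apply: contra li => /set_mem Uix; apply/eqP/(sub_disjoint Ulx Uix).
rewrite (eq_map e); suff -> s : uniq s ->
    flatten [seq if l == i then F l else [::] | l <- s] =
    if i \in s then F i else [::].
  by rewrite mem_enum.
  exact: enum_uniq.
elim: s => //= l s IH /andP[ls /IH->]; rewrite inE eq_sym; case: eqP => //= ->.
by rewrite (negPf ls) cats0.
Qed.

Lemma instance_sub omega x : x \in instance omega ->
  exists2 i, U i x & x \in gadget i (omega i).
Proof.
move=> /flattenP[s /mapP[i _ ->] xg]; exists i => //; exact: gadget_sub xg.
Qed.

Lemma filter_instance omega i :
  [seq x <- instance omega | x \in U i] = gadget i (omega i).
Proof.
by rewrite (filter_flatten_sub (f := id))// => l x; exact: gadget_sub.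
Qed.

Lemma count_instance omega i x : U i x ->
  count_mem x (instance omega) = count_mem x (gadget i (omega i)).
Proof.
move=> Ux; rewrite -filter_instance count_filter; apply: eq_count => y /=.
by case: eqP => //= ->; rewrite mem_set.
Qed.

(** * The tie-breaking strategy *)

Definition seen h i := has (fun y => y \in U i) (unzip1 h).

Lemma seenP h i : reflect (exists2 y, y \in unzip1 h & U i y) (seen h i).
Proof.
by apply: (iffP hasP) => -[y yh] => [/set_mem|/mem_set]; exists y.
Qed.

Definition first_of omega P i : item B :=
  rename (act (S i) (omega i).2) (xc P i (omega i).1).

(* An unseen gadget is represented by the one item to be received first from it:
   thus the tie-breaker reveals nothing else about the versions of unseen
   gadgets. *)
Definition source omega P h i : seq (item B) :=
  if seen h i then gadget i (omega i) else [:: first_of omega P i].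

Definition top P Y : item B :=
  if pselect (exists x, highest P Y x) is left e then projT1 (cid e) else x0.

Lemma topP P Y : Y != [::] -> highest P Y (top P Y).
Proof.
move=> Y0; rewrite /top; case: pselect => [e|]; first by case: (cid e).
case; elim: Y Y0 => // y Y IH _.
have [->|/IH[x [xY xP]]] := eqVneq Y [::].
  by exists y; split=> [|z]; rewrite ?mem_head// inE => /eqP->.
have [Pxy|/ltW Pyx] := leP (P x) (P y).
  exists y; split; rewrite ?mem_head// => z; rewrite inE => /predU1P[->//|/xP].
  by move=> /le_trans; apply.
exists x; split; rewrite ?inE ?xY ?orbT// => z; rewrite inE => /predU1P[->//|].
exact: xP.
Qed.

(** The subuniverse is picked before the item, so that instances not yet told apart pick the same
    one. [top] makes the strategy lawful also on arguments that no run reaches. *)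
Definition tie_breaker omega : strategy B := fun P h Y =>
  if [pick i | has (fun x => `[<highest P Y x>]) (source omega P h i)] is Some i
  then head x0 [seq x <- source omega P h i | `[<highest P Y x>]] else top P Y.

Lemma tie_breakerP omega : tie_breaking (tie_breaker omega).
Proof.
move=> P h Y Y0; rewrite /tie_breaker; case: pickP => [i|_]; last exact: topP.
by move=> /(head_filter x0)/andP[/asboolP].
Qed.

(** * Obliviousness: priorities within an unseen gadget *)

Local Notation reached omega t Y h w :=
  (reach A (tie_breaker omega) t (instance omega) Y h w).

Lemma reached_current omega t Y h w : reached omega t Y h w -> Y != [::] ->
  current G U A (instance omega) h (priority A h (mkseq t w)).
Proof.
move=> r Y0; exists (tie_breaker omega), t, Y, w; split=> //.
- exact: input_instance.
- exact: tie_breakerP.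
Qed.

Lemma reached_sub omega t Y h w y : reached omega t Y h w -> y \in unzip1 h ->
  exists i, U i y.
Proof.
move=> r yh; have : y \in instance omega.
  by rewrite -(perm_mem (reach_perm (@tie_breakerP omega) r)) mem_cat yh orbT.
by case/instance_sub => i Uy _; exists i.
Qed.

Lemma reached_awaiting omega h P i : current G U A (instance omega) h P ->
  ~~ seen h i -> awaiting G U A P i j0.
Proof.
move=> cur /seenP si; exists (instance omega), h; split=> //.
  by move=> y yh Uy; apply: si; exists y.
by exists (omega i).1; rewrite filter_instance; exact: gadget_copy.
Qed.

(** Obliviousness covers renamings that fix the seen names. The extension [f'] of [f] from the names
    of [x] moves only names of [x] and of [rename f x]; these lie in [N i], whereas seen names lie
    in other sets [N l]. *)
Lemma priority_rename X h P i f x : current G U A X h P ->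
  (forall y, y \in unzip1 h -> exists l, U l y) -> ~~ seen h i ->
  bijective f -> U i x -> U i (rename f x) -> P (rename f x) = P x.
Proof.
move=> cur hU si fb Ux Ufx; have [UN _ _] := subU i.
have [f' [f'b f'f f'id]] := bij_extension (names_of x) (bij_inj fb).
rewrite -(rename_local f'b fb f'f); apply: (obl cur) => //; last first.
- by exists i; rewrite (rename_local f'b fb f'f).
- by exists i.
move=> y a yh ay; have [l Uy] := hU y yh.
have Nla : N l a by have [UlN _ _] := subU l; exact: (UlN y).
have li : N i a -> False.
  move=> /(names_disjoint Nla) li; move: si => /seenP; apply.
  by exists y => //; rewrite -li.
apply: f'id; apply/negP => ax; apply: li; first exact: (UN x).
by apply: (UN (rename f x)) => //=; rewrite names_of_rename.
Qed.

(** Renaming the actual gadget onto [cpy P i j0 (omega i).1] keeps all priorities, so the item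
    matching [first P i j0] is highest in it. The highest priority is thus the same for both
    patterns and all permutations. *)
Lemma gadget_priority omega t Y h w i (P := priority A h (mkseq t w)) :
  reached omega t Y h w -> Y != [::] -> ~~ seen h i ->
  [/\ first_of omega P i \in gadget i (omega i),
      P (first_of omega P i) = P (first P i j0) &
      forall y, y \in gadget i (omega i) -> P y <= P (first P i j0)].
Proof.
move=> r Y0 si; have cur := reached_current r Y0; rewrite -/P in cur.
have aw := reached_awaiting cur si.
have [[_ cpyU] [_ Pmax]] := fic aw (omega i).1.
have [f [fb pf xg fx]] := xcP (omega i).1 aw.
have PE y : y \in g0 i (omega i).1 ->
    P (rename (act (S i) (omega i).2) y) = P (rename f y).
  move=> yg; set s := (omega i).2.
  have ab := actb i s; have [b ab' ba] := ab.
  have bb : bijective b by exists (act (S i) s).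
  (* The renaming [f \o b] undoes the permutation and then maps the fixed copy onto [cpy]. *)
  rewrite -{2}(renameK y ab bb ab') -rename_comp//; apply/esym.
  apply: (priority_rename (i := i) cur) => //.
  - by move=> z; exact: reached_sub r.
  - exact: bij_comp.
  - by apply: (@gadget_sub i (omega i)); exact: map_f.
  - rewrite rename_comp// (renameK _ ab bb ab'); apply: cpyU.
    by rewrite (perm_mem pf); exact: map_f.
split.
- exact: map_f.
- by rewrite PE// fx.
- move=> _ /mapP[y yg ->]; rewrite PE//; apply: Pmax.
  by rewrite (perm_mem pf); exact: map_f.
Qed.

Lemma unseen_remaining omega t Y h w i x : reached omega t Y h w ->
  ~~ seen h i -> x \in gadget i (omega i) -> x \in Y.
Proof.
move=> r si xg; have xX : x \in instance omega.
  by apply/flattenP; exists (gadget i (omega i)) => //; apply: map_f; rewrite mem_enum.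
move: xX; rewrite -(perm_mem (reach_perm (@tie_breakerP omega) r)) mem_cat.
case/orP => // xh; case/seenP: si; exists x => //; exact: gadget_sub xg.
Qed.

Lemma remaining_gadget omega t Y h w x : reached omega t Y h w -> x \in Y ->
  exists i, x \in gadget i (omega i).
Proof.
move=> r xY; have : x \in instance omega.
  by rewrite -(perm_mem (reach_perm (@tie_breakerP omega) r)) mem_cat xY.
by case/instance_sub => i _; exists i.
Qed.

(** * Instances that agree on the gadgets met so far *)

Definition agree h omega omega' :=
  [forall i, seen h i ==> (omega i == omega' i)].

Lemma agreeP h omega omega' :
  reflect (forall i, seen h i -> omega i = omega' i) (agree h omega omega').
Proof.
by apply: (iffP forallP) => e i; [move/(implyP (e i))/eqP|apply/implyP => /e->].
Qed.

Lemma agree_sym h omega omega' : agree h omega omega' -> agree h omega' omega.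
Proof. by move/agreeP => e; apply/agreeP => i /e. Qed.

(** Multiplicities decide: what remains of [x] is its number in the gadget minus its number in the
    history, and both are common to the two runs. *)
Lemma agree_remaining omega omega' t t' Y Y' h w w' i x :
  reached omega t Y h w -> reached omega' t' Y' h w' -> omega i = omega' i ->
  U i x -> (x \in Y) = (x \in Y').
Proof.
move=> r r' e Ux.
have cY o s Z q : reached o s Z h q ->
    count_mem x Z = (count_mem x (gadget i (o i)) - count_mem x (unzip1 h))%N.
  move=> /(reach_perm (@tie_breakerP o))/seq.permP/(_ (pred1 x)).
  by rewrite count_cat (count_instance _ Ux) => <-; rewrite addnK.
by rewrite -!has_pred1 !has_count (cY _ _ _ _ r) (cY _ _ _ _ r') e.
Qed.

Lemma agree_neq0 omega omega' t t' Y Y' h w w' :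
  reached omega t Y h w -> reached omega' t' Y' h w' -> agree h omega omega' ->
  Y != [::] -> Y' != [::].
Proof.
move=> r r' /agreeP ag /mem_neq0[x xY].
suff [y yY'] : exists y, y \in Y' by apply: contraTneq yY' => ->.
have [i xg] := remaining_gadget r xY.
have [si|si] := boolP (seen h i).
  by exists x; rewrite -(agree_remaining r r' (ag i si) (gadget_sub xg)).
have [y yg] := mem_neq0 (gadget_neq0 i (omega' i)).
by exists y; exact: unseen_remaining r' si yg.
Qed.

(** From seen gadgets the same items remain. Items of an unseen gadget [l] have priority at most
    that of [first P l j0], and both instances attain this value with an item still to come. *)
Lemma agree_highest omega omega' t Y Y' h w (P := priority A h (mkseq t w)) x x' :
  reached omega t Y h w -> reached omega' t Y' h w -> agree h omega omega' ->
  Y != [::] -> x' \in Y' -> P x' = P x -> highest P Y x -> highest P Y' x'.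
Proof.
move=> r r' ag Y0 xY' Pxx' [xY Px]; split=> // y yY'; rewrite Pxx'.
have Y'0 := agree_neq0 r r' ag Y0; move/agreeP in ag.
have [l yg] := remaining_gadget r' yY'.
have [sl|sl] := boolP (seen h l).
  by apply: Px; rewrite (agree_remaining r r' (ag l sl) (gadget_sub yg)).
have [fg fE _] := gadget_priority r Y0 sl.
have [_ _ Pl] := gadget_priority r' Y'0 sl.
apply: le_trans (Pl _ yg) _; rewrite -fE; apply: Px.
exact: unseen_remaining r sl fg.
Qed.

Lemma has_highest_source omega omega' t Y Y' h w (P := priority A h (mkseq t w)) i :
  reached omega t Y h w -> reached omega' t Y' h w -> agree h omega omega' ->
  Y != [::] -> has (fun x => `[<highest P Y x>]) (source omega P h i) ->
  has (fun x => `[<highest P Y' x>]) (source omega' P h i).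
Proof.
move=> r r' ag Y0; have Y'0 := agree_neq0 r r' ag Y0; rewrite /source.
have [si|si] := ifPn.
  move/agreeP: (ag) => /(_ i si) e /hasP[x xg /asboolP xP].
  apply/hasP; exists x; first by rewrite -e.
  apply/asboolP/(agree_highest r r' ag Y0 _ _ xP) => //.
  by rewrite -(agree_remaining r r' e (gadget_sub xg)); case: xP.
rewrite /= !orbF => /asboolP xP; apply/asboolP.
have [_ fE _] := gadget_priority r Y0 si.
have [fg' fE' _] := gadget_priority r' Y'0 si.
apply: (agree_highest r r' ag Y0 _ _ xP); last by rewrite fE fE'.
exact: unseen_remaining r' si fg'.
Qed.

(** A highest item in an unseen gadget is no better than the [first_of] item there. Hence the
    fallback [top] does not occur during a run. *)
Lemma has_source omega t Y h w (P := priority A h (mkseq t w)) :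
  reached omega t Y h w -> Y != [::] ->
  exists i, has (fun x => `[<highest P Y x>]) (source omega P h i).
Proof.
move=> r Y0; have [xY Px] := topP P Y0.
have [i xg] := remaining_gadget r xY; exists i; rewrite /source.
have [si|si] := ifPn; first by apply/hasP; exists (top P Y) => //; apply/asboolP.
have [fg fE Pi] := gadget_priority r Y0 si.
rewrite /= orbF; apply/asboolP; split=> [|y yY]; first exact: unseen_remaining r si fg.
by rewrite /P fE; apply: le_trans (Pi _ xg); exact: Px.
Qed.

(** This is how the adversary hides the unseen gadgets: by [has_highest_source], used in both
    directions, all agreeing instances pick the same subuniverse, and a newly opened gadget shows
    only its [first_of] item. *)
Lemma next_item omega t Y h w (P := priority A h (mkseq t w)) :
  reached omega t Y h w -> Y != [::] ->
  exists i, forall omega' Y', reached omega' t Y' h w -> agree h omega omega' ->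
    [/\ U i (tie_breaker omega' P h Y'),
        seen h i -> tie_breaker omega' P h Y' = tie_breaker omega P h Y
      & ~~ seen h i -> tie_breaker omega' P h Y' = first_of omega' P i].
Proof.
move=> r Y0.
pose p o Z i := has (fun x => `[<highest P Z x>]) (source o P h i).
have [i pi] : exists i, [pick i | p omega Y i] = Some i.
  case: pickP => [i _|none]; first by exists i.
  by have [i] := has_source r Y0; rewrite -/(p _ _ _) none.
exists i => omega' Y' r' ag; have Y'0 := agree_neq0 r r' ag Y0.
have pE : p omega Y =1 p omega' Y'.
  move=> l; apply/idP/idP; first exact: has_highest_source.
  exact/(has_highest_source r' r)/Y'0/agree_sym.
have pi' : [pick i | p omega' Y' i] = Some i by rewrite -(eq_pick pE).
have phas : p omega' Y' i by move: pi'; case: pickP => // l pl [<-].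
have tE o Z : [pick i | p o Z i] = Some i ->
    tie_breaker o P h Z = head x0 [seq x <- source o P h i | `[<highest P Z x>]].
  by rewrite /tie_breaker => ->.
have /andP[_] := head_filter x0 phas; rewrite -tE// => xs.
split=> [|si|si].
- move: xs; rewrite /source; case: ifPn => [_|si]; first exact: gadget_sub.
  have [fg _ _] := gadget_priority r' Y'0 si.
  by rewrite inE => /eqP ->; exact: gadget_sub fg.
- rewrite !tE// /source si; move/agreeP: (ag) => /(_ i si) e; rewrite e; congr head.
  apply: eq_in_filter => x xg; apply/asbool_equiv_eq.
  have xY := agree_remaining r r' e (gadget_sub xg).
  split=> xP; [apply: (agree_highest r' r _ _ _ _ xP)|
               apply: (agree_highest r r' _ _ _ _ xP)] => //.
  + exact: agree_sym.
  + by rewrite xY; case: xP.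
  + by rewrite -xY; case: xP.
- by move: xs; rewrite /source (negPf si) inE => /eqP.
Qed.

(** Each item comes either from a gadget on which the instances already agree, or as the first of a
    gadget that the longer history counts as seen; in both cases the two runs receive the same
    item. *)
Lemma agree_reached omega omega' t Y h w : reached omega t Y h w ->
  agree h omega omega' -> exists Y', reached omega' t Y' h w.
Proof.
move=> r; elim: r => {Y h w} [w rd|Y h w x w' r IH Y0 xE rd] ag.
  by exists (instance omega'); apply: reach_init.
have seenS i : seen h i -> seen (rcons h (x, decide A h x (mkseq t w'))) i.
  by rewrite /seen /unzip1 map_rcons -cats1 has_cat => ->.
have ag' : agree h omega omega'.
  by move/agreeP: ag => ag; apply/agreeP => i /seenS; exact: ag.
have [Y' r'] := IH ag'.
have [i nx] := next_item r Y0; have [Ui sx ux] := nx _ _ r' ag'.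
have [Ui0 _ ux0] := nx _ _ r (introT (agreeP _ _ _) (fun _ _ => erefl)).
have xE' : x = tie_breaker omega' (priority A h (mkseq t w)) h Y'.
  have [si|si] := boolP (seen h i); first by rewrite sx.
  rewrite xE ux0// ux// /first_of; move/agreeP: ag => ->//.
  rewrite /seen /unzip1 map_rcons -cats1 has_cat /= -xE in Ui0 *.
  by rewrite mem_set// orbT.
exists (rem x Y'); apply: (reach_next r' _ xE' rd).
exact: agree_neq0 r r' ag' Y0.
Qed.

(** * Counting mistakes *)

Definition mistake omega h i : bool :=
  if [seq e <- h | e.1 \in U i] is e :: _ then e.2 != (omega i).1 else false.

Definition mistakes omega h : nat := (\sum_(i < m) mistake omega h i)%N.

Definition unseen h : nat := #|[pred i | ~~ seen h i]|.

Lemma seen_rcons h e i : seen (rcons h e) i = seen h i || (e.1 \in U i).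
Proof. by rewrite /seen /unzip1 map_rcons -cats1 has_cat /= orbF. Qed.

Lemma seen_filter h i : seen h i = ([seq e <- h | e.1 \in U i] != [::]).
Proof. by rewrite /seen has_map has_filter. Qed.

Lemma mistake_rcons_seen omega omega' h e i : omega i = omega' i -> seen h i ->
  mistake omega' (rcons h e) i = mistake omega h i.
Proof.
rewrite seen_filter /mistake filter_rcons => ->.
by case: ifP; case: [seq e <- h | _].
Qed.

Lemma mistake_unseen omega h i : ~~ seen h i -> mistake omega h i = false.
Proof. by rewrite seen_filter negbK /mistake => /eqP->. Qed.

Lemma mistake_rcons_unseen omega h e i : ~~ seen h i -> U i e.1 ->
  mistake omega (rcons h e) i = (e.2 != (omega i).1).
Proof.
by rewrite seen_filter negbK /mistake filter_rcons => /eqP-> /mem_set->.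
Qed.

Lemma mistakes_rcons_seen omega h e i : seen h i -> U i e.1 ->
  mistakes omega (rcons h e) = mistakes omega h.
Proof.
move=> si Ui; apply: eq_bigr => l _; congr nat_of_bool.
have [sl|sl] := boolP (seen h l); first exact: mistake_rcons_seen.
rewrite !mistake_unseen// seen_rcons negb_or sl; apply/negP => /set_mem Ul.
by move: sl; rewrite -(sub_disjoint Ui Ul) si.
Qed.

Lemma mistakes_rcons_unseen omega omega' h e i : agree h omega omega' ->
  ~~ seen h i -> U i e.1 ->
  mistakes omega' (rcons h e) = (mistakes omega h + (e.2 != (omega' i).1))%N.
Proof.
move=> /agreeP ag si Ui; rewrite /mistakes (bigD1 i)//= [in RHS](bigD1 i)//=.
rewrite mistake_rcons_unseen// (mistake_unseen omega si) add0n addnC.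
congr addn; apply: eq_bigr => l li; congr nat_of_bool.
have [sl|sl] := boolP (seen h l); first by apply: mistake_rcons_seen => //; exact: ag.
rewrite !mistake_unseen// seen_rcons negb_or sl; apply/negP => /set_mem Ul.
by move: li; rewrite (sub_disjoint Ui Ul) eqxx.
Qed.

Lemma unseen_rcons_seen h e i : seen h i -> U i e.1 -> unseen (rcons h e) = unseen h.
Proof.
move=> si Ui; apply: eq_card => l; rewrite !inE seen_rcons negb_or.
have [//|sl] := boolP (seen h l); apply/negP => /set_mem Ul.
by move: sl; rewrite -(sub_disjoint Ui Ul) si.
Qed.

Lemma unseen_rcons_unseen h e i : ~~ seen h i -> U i e.1 ->
  unseen h = (unseen (rcons h e)).+1.
Proof.
move=> si Ui; rewrite /unseen (cardD1 i) inE si add1n; congr _.+1.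
apply: eq_card => l; rewrite !inE seen_rcons negb_or andbC; congr andb.
apply/idP/idP => [li|/negP Ul].
  by apply/negP => /set_mem Ul; move: li; rewrite (sub_disjoint Ui Ul) eqxx.
by apply/eqP => li; apply: Ul; rewrite li mem_set.
Qed.

(** [D] depends on the item alone. A permutation [s] carries the item of the accept copy to that of
    the reject copy, so shifting by [s] pairs accept and reject versions that show the same item.
    [D] errs on exactly one of each pair, which contributes [1 + z]. *)
Lemma first_item_balanced P i (D : item B -> bool) (z : R) :
  awaiting G U A P i j0 ->
  \sum_(v : bool * 'S_n) z ^+ (D (rename (act (S i) v.2) (xc P i v.1)) != v.1) =
  #|{: 'S_n}|%:R * (1 + z).
Proof.
move=> aw.
have [f [fb _ xg fx]] := xcP true aw; have [f' [fb' _ xg' fx']] := xcP false aw.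
(* Both items are renamings of [first P i j0], hence of each other, and all their names lie in
   [S i], so a permutation of [S i] realises the renaming. *)
have [s sE] : exists s : 'S_n, rename (act (S i) s) (xc P i true) = xc P i false.
  have [g gf fg] := fb'; have gb : bijective g by exists f'.
  have hb : bijective (g \o f) by exact: bij_comp.
  have hx : rename (g \o f) (xc P i true) = xc P i false.
    by rewrite rename_comp// fx -fx' renameK.
  have [||s sE] := act_extension (S_uniq i) (S_size i)
    (s := names_of (xc P i true)) (bij_inj hb).
  - exact: g0_S xg.
  - by move=> a; rewrite -(names_of_rename _ hb) hx => /(g0_S xg').
  by exists s; rewrite -hx; apply: rename_local => //; exact: actb.
rewrite -(pair_bigA _ (fun c s => z ^+ (D (rename (act (S i) s) (xc P i c)) != c))) /=.
rewrite big_bool /= (reindex_inj (mulgI s)) -big_split/=.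
rewrite (eq_bigr (fun=> 1 + z)) => [|u _]; first by rewrite sumr_const mulr_natl.
have -> : rename (act (S i) (s * u)%g) (xc P i true) =
    rename (act (S i) u) (xc P i false).
  rewrite -sE -rename_comp; [|exact: actb..].
  by congr (rename _ _); apply/funext => a; exact: actM.
by case: (D _); rewrite /= !expr0 ?expr1// addrC.
Qed.

(** By determinism a complete run passes through this state, so its reading stops there. Used
    contrapositively: where reading never stops, no complete run has to be weighed. *)
Lemma reached_next_reads omega t Y h w out w1
    (x := tie_breaker omega (priority A h (mkseq t w)) h Y) :
  reached omega t Y h w -> Y != [::] -> reached omega t [::] out w1 ->
  exists w', reads (read_next A h x) t w w'.
Proof.
move=> r Y0 ro.
have := reach_size (@tie_breakerP omega) ro.
rewrite -(reach_size (@tie_breakerP omega) r).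
rewrite add0n => sz.
have lt : (size h < size out)%N.
  by rewrite sz -[X in (X < _)%N]add0n ltn_add2r lt0n size_eq0.
have [Y1 [w' r1]] := reach_prefix ro lt.
have := reach_last r1; rewrite -size_eq0 size_takel// => /(_ isT).
move=> [Y2 [h2 [w2 [x2 [r2 Y20 x2E rd /(congr1 size)]]]]].
rewrite size_takel// size_rcons => -[sz2].
have [eY eh ew] := reach_det r r2 sz2; subst.
by exists w'.
Qed.

(** * The total weight of all instances for one fixed tape *)

Section Tape.
Variables (t : nat -> bool) (z : R) (V : {ffun 'I_m -> bool * 'S_n} -> R).
Hypothesis z_gt0 : 0 < z.
(** The value 0 is for instances on which the oracle writes a different tape, and for runs that do
    not end. *)
Hypothesis VP : forall omega, V omega = 0 \/
  exists out w, reached omega t [::] out w /\ V omega = z ^+ mistakes omega out.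

(** By [first_item_balanced], the total weight contributed by the versions of one gadget. *)
Let K : R := #|{: 'S_n}|%:R * (1 + z).

Let K_ge0 : 0 <= K.
Proof. by rewrite mulr_ge0// ler_wpDl// ltW. Qed.

Lemma agree_rcons_seen h e i omega omega' : seen h i -> U i e.1 ->
  agree (rcons h e) omega omega' = agree h omega omega'.
Proof.
move=> si Ui; apply: eq_forallb => l; rewrite seen_rcons.
have [//|sl] := boolP (seen h l); rewrite (negPf (_ : ~~ (e.1 \in U l)))//.
by apply/negP => /set_mem Ul; move: sl; rewrite -(sub_disjoint Ui Ul) si.
Qed.

Lemma agree_rcons_unseen h e i omega omega' : ~~ seen h i -> U i e.1 ->
  agree (rcons h e) omega omega' = agree h omega omega' && (omega i == omega' i).
Proof.
move=> si Ui; apply/agreeP/andP => [ag|[/agreeP ag /eqP e'] l].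
  split; last by rewrite ag// seen_rcons mem_set// orbT.
  by apply/agreeP => l sl; apply: ag; rewrite seen_rcons sl.
rewrite seen_rcons => /orP[/ag//|/set_mem Ul].
by rewrite -(sub_disjoint Ui Ul).
Qed.

Lemma V_eq0 omega Y h w : reached omega t Y h w -> Y != [::] ->
  ~ (exists w', reads (read_next A h
       (tie_breaker omega (priority A h (mkseq t w)) h Y)) t w w') ->
  V omega = 0.
Proof.
move=> r Y0 nr; have [//|[out [w1 [ro _]]]] := VP omega.
by case: nr; exact: reached_next_reads r Y0 ro.
Qed.

Let bound_ge0 o l : 0 <= z ^+ mistakes o l * K ^+ unseen l.
Proof. by rewrite mulr_ge0// exprn_ge0// ltW. Qed.

Lemma sum_runs_end omega h w : reached omega t [::] h w ->
  \sum_(omega' | agree h omega omega') V omega' <=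
  z ^+ mistakes omega h * K ^+ unseen h.
Proof.
move=> r; have sn i : seen h i.
  apply/negPn/negP => si; have [y yg] := mem_neq0 (gadget_neq0 i (omega i)).
  by have := unseen_remaining r si yg.
rewrite (big_pred1 omega) => [|omega']; last first.
  rewrite /= eq_sym; apply/agreeP/eqP => [ag|-> //]; apply/ffunP => i; exact: ag.
have -> : unseen h = 0%N by apply: eq_card0 => i; rewrite !inE sn.
rewrite expr0 mulr1; have [->|[out [w1 [ro ->]]]] := VP omega.
  by rewrite exprn_ge0// ltW.
have := reach_size (@tie_breakerP omega) ro.
rewrite -(reach_size (@tie_breakerP omega) r) /= !add0n => sz.
by have [_ -> _] := reach_det ro r sz.
Qed.

(** Receiving an item from a gadget already met changes neither side. A new gadget splits the sum by
    its version; the induction hypothesis bounds each branch, and [first_item_balanced] adds the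
    branches up to one factor [K]. The fuel [f] bounds the iterations left. *)
Lemma sum_runs_from f omega Y h w : reached omega t Y h w ->
  (forall omega', (size (instance omega') <= f + size h)%N) ->
  \sum_(omega' | agree h omega omega') V omega' <=
  z ^+ mistakes omega h * K ^+ unseen h.
Proof.
elim: f omega Y h w => [|f IH] omega Y h w r le.
all: have [Y0|Y0] := eqVneq Y [::]; first by rewrite Y0 in r; exact: sum_runs_end r.
  (* Without fuel the remaining input is empty, against [Y0]. *)
  move: (le omega); rewrite add0n -(reach_size (@tie_breakerP omega) r).
  by rewrite -[X in (_ <= X)%N]add0n leq_add2r leqn0 size_eq0 (negPf Y0).
set P := priority A h (mkseq t w); have [i nx] := next_item r Y0.
have le' e omega' : (size (instance omega') <= f + size (rcons h e))%N.
  by rewrite size_rcons addnS -addSn.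
have step o Z w' (x := tie_breaker o P h Z) : reached o t Z h w -> Z != [::] ->
    reads (read_next A h x) t w w' ->
    \sum_(o' | agree (rcons h (x, decide A h x (mkseq t w'))) o o') V o' <=
    z ^+ mistakes o (rcons h (x, decide A h x (mkseq t w'))) *
    K ^+ unseen (rcons h (x, decide A h x (mkseq t w'))).
  by move=> ro Z0 rd; apply: (IH _ _ _ _ (reach_next ro Z0 erefl rd)).
have ag0 : agree h omega omega by apply/agreeP.
have [Ui _ _] := nx _ _ r ag0.
have [si|si] := boolP (seen h i).
  have [[w' rd]|nr] := pselect (exists w', reads (read_next A h
      (tie_breaker omega P h Y)) t w w').
    have := step _ _ _ r Y0 rd; set e := (_, decide _ _ _ _).
    have Ue : U i e.1 by [].
    rewrite (mistakes_rcons_seen _ si Ue) (unseen_rcons_seen si Ue).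
    by under eq_bigl do rewrite (agree_rcons_seen _ _ si Ue).
  rewrite big1// => o ag; have [Z ro] := agree_reached r ag.
  apply: (V_eq0 ro (agree_neq0 r ro ag Y0)).
  by have [_ /(_ si) -> _] := nx _ _ ro ag.
(* By [reads_uniq] the decision is a function of the item received. The value [true] where reading
   never stops is arbitrary, since [V] vanishes there. *)
pose D x := if pselect (exists w', reads (read_next A h x) t w w') is left e
  then decide A h x (mkseq t (projT1 (cid e))) else true.
rewrite (partition_big (fun o : {ffun 'I_m -> bool * 'S_n} => o i) predT)//=.
have aw := reached_awaiting (reached_current r Y0) si.
have uE e : U i e.1 -> unseen h = (unseen (rcons h e)).+1.
  exact: unseen_rcons_unseen.
have [u uh] : exists u, unseen h = u.+1.
  by exists (unseen (rcons h (tie_breaker omega P h Y, true))); exact: uE.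
rewrite uh exprS -/P in aw *.
rewrite {1}/K -(first_item_balanced D z aw) mulrA mulr_sumr mulr_suml.
apply: ler_sum => v _.
(* [o] represents the branch in which the new gadget has version [v]. *)
pose o := [ffun l => if l == i then v else omega l].
have oi : o i = v by rewrite ffunE eqxx.
have ag : agree h omega o.
  apply/agreeP => l sl; rewrite ffunE; case: eqP => // li.
  by move: si; rewrite -li sl.
have [Z ro] := agree_reached r ag; have Z0 := agree_neq0 r ro ag Y0.
have [Uo _ /(_ si) xE] := nx _ _ ro ag; rewrite -/P in Uo xE.
have agE o' : agree h omega o' && (o' i == v) = agree h o o' && (o i == o' i).
  rewrite oi eq_sym; congr andb; apply/agreeP/agreeP => ag' l sl.
    by rewrite -ag'//; move/agreeP: ag => ->.
  by rewrite -ag'//; move/agreeP: ag => ->.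
rewrite (eq_bigl _ _ agE).
have -> : rename (act (S i) v.2) (xc P i v.1) = tie_breaker o P h Z.
  by rewrite xE /first_of oi.
have [[w' rd]|nr] := pselect (exists w', reads (read_next A h
    (tie_breaker o P h Z)) t w w').
  have := step _ _ _ ro Z0 rd; set x := tie_breaker o P h Z in rd Uo *.
  have -> : decide A h x (mkseq t w') = D x.
    rewrite /D; case: pselect => [e|[]]; last by exists w'.
    by case: (cid e) => /= w'' rd'; rewrite (reads_uniq rd rd').
  have xU : U i (x, D x).1 by [].
  rewrite (mistakes_rcons_unseen ag si xU) oi /=.
  have [<-] : (unseen (rcons h (x, D x))).+1 = u.+1 by rewrite -uh -uE.
  under eq_bigl do rewrite (agree_rcons_unseen _ _ si xU).
  by rewrite exprD oi.
rewrite big1 => [|o' /andP[ag' /eqP o'i]].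
  by rewrite !mulr_ge0// exprn_ge0// ltW.
have agg : agree h omega o'.
  by have := agE o'; rewrite ag' o'i eqxx => /andP[].
have [Z' ro'] := agree_reached r agg.
apply: (V_eq0 ro' (agree_neq0 r ro' agg Y0)).
have [_ _ /(_ si) xE'] := nx _ _ ro' agg.
rewrite -/P xE' /first_of -o'i oi -/(first_of _ _ _).
by move: nr; rewrite xE /first_of oi.
Qed.

Lemma sum_runs : \sum_omega V omega <= K ^+ m.
Proof.
have [[w rd]|nr] := pselect (exists w, reads (read_init A) t 0 w); last first.
  rewrite big1 => [|omega _]; first exact: exprn_ge0.
  have [//|[out [w1 [ro _]]]] := VP omega.
  have [Y [w]] := reach_prefix ro (leq0n _); rewrite take0 => r0.
  by case: nr; exists w; exact: reach_nil r0.
pose omega0 : {ffun 'I_m -> bool * 'S_n} := [ffun=> (true, 1%g)].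
have := sum_runs_from (f := \max_omega size (instance omega))
  (reach_init (tie_breaker omega0) (instance omega0) rd).
rewrite addn0 => /(_ (fun omega => leq_bigmax omega)).
have -> : mistakes omega0 [::] = 0%N by rewrite /mistakes big1.
have -> : unseen [::] = m by rewrite -[RHS]card_ord; apply: eq_card => i; rewrite !inE.
rewrite expr0 mul1r; apply: le_trans.
rewrite [leRHS](eq_bigl xpredT)// => omega.
by apply/agreeP => i; rewrite seen_filter.
Qed.

End Tape.

(** * From mistakes to the objective value *)

Lemma first_item_of omega t Y h w i e s : reached omega t Y h w ->
  [seq e <- h | e.1 \in U i] = e :: s ->
  exists2 P, awaiting G U A P i j0 & e.1 = first_of omega P i.
Proof.
move=> r; elim: r e s => {Y h w} [//|Y h w x w' r IH Y0 xE rd] e s.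
rewrite filter_rcons /=; have [si|si] := boolP (seen h i).
  have : [seq e <- h | e.1 \in U i] != [::] by rewrite -seen_filter.
  case hE: [seq _ <- h | _] => [//|e' s'] _.
  by case: ifP => _; [case=> <- _|case=> <- _]; exact: IH hE.
have /eqP-> : [seq e <- h | e.1 \in U i] == [::].
  by rewrite -(negbK (_ == _)) -seen_filter.
case: ifP => // /set_mem Ui [<- _] /=.
exists (priority A h (mkseq t w)).
  exact: reached_awaiting (reached_current r Y0) si.
have [l nx] := next_item r Y0.
have [Ul _ fE] := nx _ _ r (introT (agreeP _ _ _) (fun _ _ => erefl)).
by rewrite xE in Ui *; rewrite -(sub_disjoint Ul Ui) in si *; exact: fE.
Qed.

Lemma first_of_opt_with omega P i d : awaiting G U A P i j0 ->
  opt_with (gadget i (omega i)) (first_of omega P i) d =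
  opt_with (cpy P i j0 (omega i).1) (first P i j0) d.
Proof.
move=> aw; have [f [fb pf xg fx]] := xcP (omega i).1 aw.
by rewrite (opt_with_perm _ _ pf) -fx !opt_with_rename//; exact: actb.
Qed.

Section Outcome.
Variables (omega : {ffun 'I_m -> bool * 'S_n}) (t : nat -> bool).
Variables (out : seq (item B * bool)) (w : nat).
Hypothesis run_out : reached omega t [::] out w.

Let part i := [seq e <- out | e.1 \in U i].

Lemma part_perm i : perm_eq (unzip1 (part i)) (gadget i (omega i)).
Proof.
rewrite -filter_instance /unzip1 /part -(filter_map fst (fun x => x \in U i)).
exact/perm_filter/(reach_perm (@tie_breakerP omega) run_out).
Qed.

Lemma part_sub i e : e \in part i -> U i e.1.
Proof. by rewrite mem_filter => /andP[/set_mem]. Qed.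

Lemma perm_parts : perm_eq out (flatten [seq part i | i <- enum 'I_m]).
Proof.
apply/allP => e eo; apply/eqP.
have [i Ui] : exists i, U i e.1.
  move: eo; rewrite mem_cat => /orP[eo|].
    exact: reached_sub run_out (map_f _ eo).
  by move=> /flattenP[_ /mapP[i _ ->] /part_sub]; exists i.
have cE s : count_mem e s = count_mem e [seq e' <- s | e'.1 \in U i].
  rewrite count_filter; apply: eq_count => e' /=.
  by case: eqP => //= ->; rewrite mem_set.
rewrite cE [RHS]cE; congr count.
by rewrite (filter_flatten_sub (F := part)) // => l z; exact: part_sub.
Qed.

Lemma obj_parts : additivity G U -> obj out = (\sum_(i < m) obj (part i))%E.
Proof.
move=> add; rewrite (obj_perm perm_parts) add// => i.
exists j0, (omega i).1; have [[f fb pf] gU] := gadget_copy i (omega i).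
split; first by exists f => //; exact: perm_trans (part_perm i) pf.
by move=> x; rewrite (perm_mem (part_perm i)); exact: gU.
Qed.

Lemma obj_part_opt i : (obj (part i) <= opt (G j0 (omega i).1))%E.
Proof.
rewrite -(opt_copy_in (gadget_copy i (omega i))); apply: obj_le_opt.
exact: part_perm.
Qed.

Lemma obj_part_bad i : mistake omega out i ->
  (obj (part i) <= bad G U A first cpy j0 (omega i).1)%E.
Proof.
rewrite /mistake; case pE: [seq _ <- out | _] => [//|[x d] s] /= dE.
have [P aw /= xE] := first_item_of run_out pE.
have dE' : d = ~~ (omega i).1 by case: d dE {pE}; case: (omega i).1.
rewrite /part pE; apply: (@le_trans _ _ (opt_with (gadget i (omega i)) x d)).
  by apply: obj_le_opt_with; have := part_perm i; rewrite /part pE.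
rewrite xE dE' first_of_opt_with//; apply: ereal_sup_ubound.
by exists P, i.
Qed.

End Outcome.

Lemma opt_instance_ge omega : additivity G U ->
  (\sum_(i < m) opt (G j0 (omega i).1) <= opt (instance omega))%E.
Proof.
move=> add.
have /choice[D DP] : forall i, exists D,
    unzip1 D = gadget i (omega i) /\ obj D = opt (gadget i (omega i)).
  by move=> i; have [D] := opt_attained (gadget i (omega i)); exists D.
rewrite (eq_bigr (fun i => obj (D i))) => [|i _]; last first.
  by have [_ ->] := DP i; rewrite (opt_copy_in (gadget_copy i (omega i))).
rewrite -add => [|i]; last by have [-> _] := DP i; exact: gadget_gadget_in.
apply: obj_le_opt; rewrite /unzip1 map_flatten -map_comp.
by rewrite (eq_map (fun i => (DP i).1)).
Qed.

(** Turns the advice bound, stated per input item, into one per gadget. *)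
Lemma size_instance omega : (size (instance omega) <= m * max_size G)%N.
Proof.
rewrite size_flatten /shape -map_comp sumnE big_map big_enum /=.
rewrite -[X in (_ <= X * _)%N]card_ord -sum_nat_const; apply: leq_sum => i _.
have [[f _ /perm_size ->] _] := gadget_copy i (omega i); rewrite size_map.
apply: leq_trans (leq_bigmax j0); case: (omega i).1; [exact: leq_maxl|exact: leq_maxr].
Qed.

Lemma max_size_gt0 : (0 < max_size G)%N.
Proof.
apply: leq_trans (leq_bigmax j0); rewrite leq_max lt0n size_eq0.
by rewrite G_neq0.
Qed.

(** * Averaging over advice strings, and the resulting ratio *)

Lemma many_mistakes (phi : oracle B) (eps : R) : 0 < eps -> eps <= 2^-1 ->
  advice_less_than G U A phi
    (fun n => (1 - entropy eps) * n%:R / (max_size G)%:R) ->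
  exists omega out w,
    reached omega (phi (instance omega) (tie_breaker omega)) [::] out w /\
    eps * m%:R <= (mistakes omega out)%:R.
Proof.
move=> e0 e2 adv; apply/not_existsP => none.
pose tape omega := phi (instance omega) (tie_breaker omega).
have /choice[ow owP] : forall omega, exists ow : seq (item B * bool) * nat,
    reached omega (tape omega) [::] ow.1 ow.2 /\
    ow.2%:R < (1 - entropy eps) * m%:R.
  move=> omega.
  have [out [w [ro lt]]] := adv _ _ (input_instance omega) (@tie_breakerP omega).
  exists (out, w); split=> //=; apply: (lt_le_trans lt).
  have s0 : 0 < (max_size G)%:R :> R by rewrite ltr0n max_size_gt0.
  (* If [entropy eps] exceeded 1, the advice bound would be at most 0, and no number of bits is
     below that. *)
  have H0 : 0 <= 1 - entropy eps.
    rewrite leNgt; apply/negP => H0; have := ler0n R w; rewrite leNgt => /negP; apply.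
    by apply: (lt_le_trans lt); rewrite -mulrA nmulr_rle0// divr_ge0// ltW.
  rewrite ler_pdivrMr// -mulrA ler_wpM2l// -natrM ler_nat; exact: size_instance.
(* The maximum is attained by some instance, so it satisfies the same strict bound. *)
pose b := \max_omega (ow omega).2.
have b_lt : b%:R < (1 - entropy eps) * m%:R.
  have card0 : (0 < #|{: {ffun 'I_m -> bool * 'S_n}}|)%N.
    by apply/card_gt0P; exists [ffun=> (true, 1%g)].
  have [omega bE] := bigop.eq_bigmax (fun omega => (ow omega).2) card0.
  by rewrite /b bE; case: (owP omega).
have [e1 z0 z1] := odds_le1 e0 e2; set z := eps / (1 - eps) in z0 z1.
pose mist omega := mistakes omega (ow omega).1.
(* Each instance is charged to the one string of [b] bits that starts its oracle tape. Padding with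
   [false] turns a string back into a tape; the run does not notice, as it reads at most [b]
   bits. *)
pose advice omega : {ffun 'I_b -> bool} := [ffun l : 'I_b => tape omega l].
pose extend (a : {ffun 'I_b -> bool}) l := if insub l is Some i then a i else false.
pose V a omega := if a == advice omega then z ^+ mist omega else 0.
have sumV a : \sum_omega V a omega <= (#|{: 'S_n}|%:R * (1 + z)) ^+ m.
  apply: (sum_runs (t := extend a)) => // omega; rewrite /V.
  case: eqP => [->|_]; [right|by left].
  have [ro _] := owP omega; exists (ow omega).1, (ow omega).2; split=> //.
  apply: eq_reach ro => l; rewrite inE => lw.
  have lb : (l < b)%N by apply: leq_trans lw (leq_bigmax omega).
  by rewrite /extend insubT ffunE.
have : \sum_a \sum_omega V a omega <=
    \sum_(a : {ffun 'I_b -> bool}) (#|{: 'S_n}|%:R * (1 + z)) ^+ m.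
  by apply: ler_sum => a _; exact: sumV.
rewrite exchange_big/= sumr_const card_ffun card_bool card_ord.
under eq_bigr do rewrite /V -big_mkcond/= big_pred1_eq.
apply/negP; rewrite -ltNge.
(* By [none] every instance has fewer than [eps * m] mistakes, and [z] is at most 1. *)
have lower : \sum_(omega : {ffun 'I_m -> bool * 'S_n}) z `^ (eps * m%:R) <=
    \sum_omega z ^+ mist omega.
  apply: ler_sum => omega _; apply: powR_le_exprn => //.
  rewrite leNgt; apply/negP => /ltW le; apply: (none omega).
  by have [ro _] := owP omega; exists (ow omega).1, (ow omega).2.
apply: lt_le_trans lower; rewrite ltNge; apply/negP => upper.
suff : (1 - entropy eps) * m%:R <= b%:R by rewrite leNgt b_lt.
have K0 : 0 < #|{: 'S_n}|%:R :> R by rewrite ltr0n; apply/card_gt0P; exists 1%g.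
apply: (entropy_bound e0 e1 K0); move: upper.
rewrite sumr_const card_ffun card_prod card_bool card_ord.
by rewrite -(mulr_natl (z `^ _)) -(mulr_natl (_ ^+ m)) !natrX natrM.
Qed.

Lemma approximation_ratio_ge (phi : oracle B) (O : bool -> R) (rho eps : R) :
  additivity G U -> (forall c, opt (G j0 c) = (O c)%:E) ->
  (forall c, (bad G U A first cpy j0 c <= (O c / rho)%:E)%E) ->
  0 < O true -> O true <= O false -> 1 <= rho -> 0 < eps -> eps <= 2^-1 ->
  advice_less_than G U A phi
    (fun n => (1 - entropy eps) * n%:R / (max_size G)%:R) ->
  ((1 + eps * (rho - 1) * O true /
     (eps * O true + (1 - eps) * rho * O false))%:E <=
   approximation_ratio G U A phi)%E.
Proof.
move=> add optE badE O1 O10 rho1 e0 e2 adv.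
have [e1 _ _] := odds_le1 e0 e2.
have rho0 : 0 < rho by exact: lt_le_trans rho1.
have [omega [out [w [ro mist]]]] := many_mistakes e0 e2 adv.
pose val i := O (omega i).1; pose wrong i := mistake omega out i.
have O_ge c : O true <= O c by case: c.
have O_le c : O c <= O false by case: c.
have val0 i : 0 <= val i by apply: le_trans (ltW O1) (O_ge _).
pose T := \sum_i val i; pose L := \sum_(i | wrong i) val i.
have TL : T - L = \sum_(i | ~~ wrong i) val i.
  by rewrite /T (bigID wrong)/= addrAC subrr add0r.
pose M : R := (mistakes omega out)%:R.
have ME : M = \sum_(i | wrong i) 1.
  rewrite /M /mistakes natr_sum [RHS]big_mkcond; apply: eq_bigr => i _.
  by rewrite /wrong; case: mistake.
have mE : m%:R - M = \sum_(i | ~~ wrong i) 1.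
  rewrite ME -[m in m%:R]card_ord -sum1_card natr_sum (bigID wrong)/=.
  by rewrite addrAC subrr add0r.
apply: (@le_trans _ _ (value_ratio (opt (instance omega)) (obj out))); last first.
  apply: ereal_sup_ubound; exists (instance omega), (tie_breaker omega), out, w.
  by split=> //; [exact: input_instance|exact: tie_breakerP].
apply: (@value_ratio_ge _ _ _ T (T - (1 - rho^-1) * L)).
- exact: sumr_ge0.
- by rewrite -sumEFin; under eq_bigr do rewrite -optE; exact: opt_instance_ge.
(* A gadget with a mistake yields at most [val i / rho], any other at most [val i]. *)
- have -> : T - (1 - rho^-1) * L =
      \sum_i if wrong i then val i / rho else val i.
    rewrite [RHS](bigID wrong)/= [X in _ = X + _](eq_bigr (fun i => val i / rho)).
      rewrite [X in _ = _ + X](eq_bigr val) => [|i /negPf->//].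
      by rewrite -TL -mulr_suml -/L; ring.
    by move=> i ->.
  rewrite (obj_parts ro add) -sumEFin; apply: lee_sum => i _.
  rewrite /wrong; case: ifPn => [wi|_].
    exact: le_trans (obj_part_bad ro wi) (badE _).
  by rewrite /val -optE; exact: obj_part_opt ro i.
- apply: ratio_bound => //.
  + exact: sumr_ge0.
  + by rewrite -subr_ge0 TL sumr_ge0.
  (* Gadgets with a mistake weigh at least [O true] each and the others at most [O false], which
     reduces the claim to [eps * m <= M]. *)
  + have L_ge : M * O true <= L.
      by rewrite ME mulr_suml; apply: ler_sum => i _; rewrite mul1r; exact: O_ge.
    have TL_le : T - L <= (m%:R - M) * O false.
      by rewrite TL mE mulr_suml; apply: ler_sum => i _; rewrite mul1r; exact: O_le.
    have O0 : 0 < O false by exact: lt_le_trans O10.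
    apply: (@le_trans _ _ (eps * O true * ((m%:R - M) * O false))).
      by rewrite ler_wpM2l// mulr_ge0// ltW.
    apply: (@le_trans _ _ ((1 - eps) * O false * (M * O true))); last first.
      by rewrite ler_wpM2l// mulr_ge0 ?subr_ge0// ltW.
    rewrite -subr_ge0.
    rewrite [leRHS](_ : _ = O true * O false * (M - eps * m%:R)); last by ring.
    by rewrite !mulr_ge0 ?subr_ge0// ltW.
Qed.

End Adversary.

(** * Choosing the fixed copies, and conclusion *)

Lemma common_hosts (R : realType) (B : problem R) (k m : nat)
    (G : 'I_k -> bool -> seq (item B)) (N : 'I_m -> set (name B))
    (U : 'I_m -> set (item B)) (j : 'I_k) : (0 < m)%N ->
  (forall i, subuniverse G (N i) (U i)) -> disjoint_copies N U ->
  exists n (S : 'I_m -> seq (name B)) (g : 'I_m -> bool -> seq (item B)),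
    [/\ forall i, uniq (S i) /\ size (S i) = n,
        forall i a, a \in S i -> N i a,
        forall i c, copy_in (U i) (G j c) (g i c) &
        forall i c x, x \in g i c -> {subset names_of x <= S i}].
Proof.
move=> m0 subU disj; pose i0 := Ordinal m0.
have /choice[h hP] : forall c, exists h, copy_in (U i0) (G j c) h.
  by move=> c; have [_ _] := subU i0; apply.
(* One pair of copies in [U i0] is carried to every [U i] by a renaming, so all lists [S i] have the
   same length and one group ['S_n] serves them all. *)
have /choice[f fP] : forall i, exists f, bijective f /\
    forall x, U i0 x -> U i (rename f x).
  move=> i; have [<-|ii] := eqVneq i0 i.
    by exists id; split=> [|x]; [exists id|rewrite rename_id].
  have [_ _ [f fb UE]] := disj _ _ ii.
  by exists f; split=> // x Ux; rewrite UE; exists x.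
(* The names of both copies are collected, since permutations must be able to carry an item of one
   copy to an item of the other. *)
pose S0 := undup (flatten [seq names_of x | x <- h true ++ h false]).
have hS0 c x : x \in h c -> {subset names_of x <= S0}.
  move=> xh a ax; rewrite mem_undup; apply/flattenP; exists (names_of x) => //.
  by apply: map_f; rewrite mem_cat; case: c xh => ->; rewrite ?orbT.
exists (size S0), (fun i => map (f i) S0), (fun i c => map (rename (f i)) (h c)).
split.
- move=> i; have [fb _] := fP i.
  by rewrite size_map map_inj_uniq ?undup_uniq//; exact: bij_inj.
- move=> i _ /mapP[a aS ->]; have [fb fU] := fP i; have [UN _ _] := subU i.
  move: aS; rewrite mem_undup => /flattenP[_ /mapP[x xh ->] ax].
  apply: (UN (rename (f i) x)); last by rewrite /= names_of_rename// map_f.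
  apply: fU; move: xh; rewrite mem_cat => /orP[] xh.
    by have [_] := hP true; apply.
  by have [_] := hP false; apply.
- move=> i c; have [fb fU] := fP i; have [[e eb pe] hU] := hP c.
  split; last by move=> _ /mapP[x xh ->]; exact/fU/hU.
  exists (f i \o e); first exact: bij_comp.
  rewrite (eq_map (fun x => rename_comp x fb eb)) [X in perm_eq _ X]map_comp.
  exact: perm_map.
- move=> i c _ /mapP[x xh ->] a; have [fb _] := fP i.
  by rewrite names_of_rename// => /mapP[b /(hS0 _ _ xh) bS ->]; exact: map_f.
Qed.

Lemma copy_in_renaming (R : realType) (B : problem R) (V : set (item B))
    (X g g' : seq (item B)) : copy_in V X g -> copy_in V X g' ->
  exists2 f, bijective f & perm_eq g' (map (rename f) g).
Proof.
move=> [[e eb pe] _] [[e' eb' pe'] _]; have [d ed de] := eb.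
have db : bijective d by exists e.
exists (e' \o d); first exact: bij_comp.
rewrite (permPl pe') perm_sym; apply: perm_trans (perm_map _ pe) _.
rewrite -map_comp (eq_map (g := rename e'))// => x /=.
by rewrite rename_comp// (renameK _ eb db ed).
Qed.

Theorem theorem6 (R : realType) (B : problem R) (k m : nat)
    (G : 'I_k -> bool -> seq (item B))
    (N : 'I_m -> set (name B)) (U : 'I_m -> set (item B))
    (A : algorithm B) (phi : oracle B)
    (first : (item B -> R) -> 'I_m -> 'I_k -> item B)
    (cpy : (item B -> R) -> 'I_m -> 'I_k -> bool -> seq (item B))
    (OPTa OPTr rho eps : R) (BADa BADr : \bar R) :
  (0 < k)%N -> (0 < m)%N ->
  (forall j c, valid (G j c)) ->
  (forall i, subuniverse G (N i) (U i)) ->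
  additivity G U ->
  consistency G U ->
  disjoint_copies N U ->
  oblivious G U A ->
  first_item_condition G U A first cpy ->
  distinguishing_decision_condition G U A first cpy ->
  (forall j, opt (G j true) = OPTa%:E) ->
  (forall j, opt (G j false) = OPTr%:E) ->
  (forall j, bad G U A first cpy j true = BADa) ->
  (forall j, bad G U A first cpy j false = BADr) ->
  0 < OPTa -> OPTa <= OPTr ->
  rho%:E = mine (value_ratio OPTa%:E BADa) (value_ratio OPTr%:E BADr) ->
  0 < eps -> eps <= 2^-1 ->
  ~ (advice_less_than G U A phi
       (fun n => (1 - entropy eps) * n%:R / (max_size G)%:R) /\
     (approximation_ratio G U A phi <
        (1 + eps * (rho - 1) * OPTa
             / (eps * OPTa + (1 - eps) * rho * OPTr))%:E)%E).
Proof.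
move=> k0 m0 _ subU add cons disj obl [ident ficP] _ optA optR badA badR.
move=> OPTa0 OPTar rhoE e0 e2 [adv]; apply/negP; rewrite -leNgt.
pose j0 := Ordinal k0.
have fic P i : awaiting G U A P i j0 -> forall c,
    copy_in (U i) (G j0 c) (cpy P i j0 c) /\ highest P (cpy P i j0 c) (first P i j0).
  by move=> /ficP[].
pose O (c : bool) := if c then OPTa else OPTr.
pose b c := bad G U A first cpy j0 c.
have O0 c : 0 < O c by case: c => //; exact: lt_le_trans OPTar.
have optE c : opt (G j0 c) = (O c)%:E by case: c.
have bO c : (b c <= (O c)%:E)%E.
  apply: ge_ereal_sup => _ [P [i [aw ->]]]; have [cp _] := fic P i aw c.
  by rewrite -optE -(opt_copy_in cp); exact: opt_with_le_opt.
have [|rho1 [c bc] b_le] := bad_le_opt_div O0 bO (rho := rho).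
  by rewrite rhoE /b badA badR.
(* Otherwise [bad] would be the supremum of the empty set, [-oo], against [bc]. *)
have [P0 [i0 aw0]] : exists P i, awaiting G U A P i j0.
  apply/not_existsP => none; move: bc; rewrite /b /bad.
  rewrite (_ : [set v | _] = set0) ?ereal_sup0//.
  by apply/seteqP; split=> // v [P [i [aw _]]]; case: (none P); exists i.
(* The copy contains its [first] item and has the size of the pattern. *)
have G_neq0 c' : G j0 c' != [::].
  have [[[f _ /perm_size]]] := fic P0 i0 aw0 c'; rewrite size_map => sz _ [+ _].
  by apply: contraTneq => G0; move: sz; rewrite G0 => /size0nil ->.
have [n [S [g [S_us S_N g_copy g_S]]]] := common_hosts j0 m0 subU disj.
(* Any item serves as the default value. *)
pose x0 := first P0 i0 j0.
have /choice[xc xcP] : forall Pic : (item B -> R) * 'I_m * bool, exists x,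
    awaiting G U A Pic.1.1 Pic.1.2 j0 ->
    preimage_of_first first cpy j0 g Pic.1.1 Pic.1.2 Pic.2 x.
  move=> [[P i] c'] /=; have [aw|] := pselect (awaiting G U A P i j0); last first.
    by exists x0.
  have [cp [fc _]] := fic P i aw c'.
  have [f fb pf] := copy_in_renaming (g_copy i c') cp.
  move: fc; rewrite (perm_mem pf) => /mapP[x xg xE].
  by exists x => _; exists f.
pose xc' P i c' := xc (P, i, c').
have xcP' P i c' : awaiting G U A P i j0 ->
    preimage_of_first first cpy j0 g P i c' (xc' P i c') by exact: (xcP (P, i, c')).
exact: (approximation_ratio_ge x0 subU cons disj obl fic
  (fun i => (S_us i).1) (fun i => (S_us i).2) S_N g_copy g_S G_neq0 xcP'
  add optE b_le OPTa0 OPTar rho1 e0 e2 adv).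
Qed.
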